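(* Let $\mathcal G=[\tfrac12,2]^2\cap\{(x_1,x_2)\in\mathbb R^2 : x_1x_2\le 1\}$, and let $\mathcal N(\mathcal G)$ be the convex cone of all real polynomials in $(x_1,x_2)$ of degree at most two that are nonnegative on $\mathcal G$. The extreme rays of $\mathcal N(\mathcal G)$ are precisely the rays spanned by the following quadratics: (i) the squares $\ell^2$, where $\ell$ is a nonzero affine function on $\mathbb R^2$ whose zero set contains two distinct points of $\mathcal G$; (ii) the products $\ell_{AB}\ell_{BC}$, $\ell_{AC}\ell_{BC}$, $\ell_{AB}\ell_{AC}$; (iii) $\ell_\Gamma$; (iv) $f_u:=\ell_{AB}(2-x_1)+u^2\ell_{AC}(2-x_2)-4u\,\ell_{AB}\ell_{AC}$, for $\tfrac12\le u\le 2$; (v) for $\tfrac12\le v<2$ and $\tfrac12\le w<\frac{2+3v}{4}$, the quadratics $$g^1_{v,w}:=\alpha_{v,w}\left(x_1+\frac v2x_2-v-\frac12\right)^2+(\alpha_{v,w}-1)f_v+\beta_{v,w}\ell_\Gamma,$$ where $$\alpha_{v,w}:=\frac{16(2-w)^2}{9(2-v)^2},\qquad \beta_{v,w}:=4w-5+3(1-v)\alpha_{v,w},$$ and the quadratics $g^2_{v,w}(x_1,x_2):=g^1_{v,w}(x_2,x_1)$. Moreover, $\mathcal N(\mathcal G)$ is the conic hull of these rays.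
   Context: Notation: $\ell_{AB}=x_1-\tfrac12$, $\ell_{AC}=x_2-\tfrac12$, $\ell_\Gamma=1-x_1x_2$, $\ell_{BC}=\tfrac52-x_1-x_2$. ''Quadratic'' means a polynomial of degree at most two in $(x_1,x_2)$. A nonzero $q\in\mathcal N(\mathcal G)$ spans an extreme ray if whenever $q=q_1+q_2$ with $q_1,q_2\in\mathcal N(\mathcal G)$, both $q_1$ and $q_2$ are nonnegative multiples of $q$. The conic hull is the set of all finite nonnegative linear combinations. *)

(* Defs.v *)
From mathcomp Require Import all_boot all_order all_algebra.
From mathcomp Require Import boolp classical_sets reals.
From mathcomp Require Import mpoly.

Set Implicit Arguments.
Unset Strict Implicit.
Unset Printing Implicit Defensive.

Import Order.TTheory GRing.Theory Num.Theory.
Local Open Scope classical_set_scope.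
Local Open Scope ring_scope.

Section Cones.
Variable R : realType.

(* Points of the plane are row vectors; x_1 and x_2 are the coordinates of
   index 0 and 1, both for points and for the variables of {mpoly R[2]}. *)
Definition region : set 'rV[R]_2 :=
  [set x | (forall i, 2^-1 <= x 0 i <= 2)] `&` [set x | x 0 0 * x 0 1 <= 1].

(* msize is 1 + the total degree (and 0 for the zero polynomial). *)
Definition nonneg_quadratics (D : set 'rV[R]_2) : set {mpoly R[2]} :=
  [set q | (msize q <= 3)%N /\ forall x, D x -> 0 <= q.@[x 0]].

Definition spans_extreme_ray (K : set {mpoly R[2]}) (q : {mpoly R[2]}) : Prop :=
  [/\ K q, q != 0 &
      forall q1 q2, K q1 -> K q2 -> q = q1 + q2 ->
        (exists2 c : R, 0 <= c & q1 = c *: q) /\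
        (exists2 c : R, 0 <= c & q2 = c *: q)].

Definition ray (q : {mpoly R[2]}) : set {mpoly R[2]} :=
  [set c *: q | c in [set c : R | 0 <= c]].

Definition extreme_rays (K : set {mpoly R[2]}) : set (set {mpoly R[2]}) :=
  [set ray q | q in spans_extreme_ray K].

Definition conic_hull (S : set {mpoly R[2]}) : set {mpoly R[2]} :=
  [set q | exists (n : nat) (c : 'I_n -> R) (p : 'I_n -> {mpoly R[2]}),
     [/\ forall i, 0 <= c i, forall i, S (p i) & q = \sum_(i < n) c i *: p i]].

End Cones.

Section Quadratics.
Variable R : realType.

Definition X1 : {mpoly R[2]} := 'X_0.
Definition X2 : {mpoly R[2]} := 'X_1.

Definition l_AB : {mpoly R[2]} := X1 - (2^-1)%:MP.
Definition l_AC : {mpoly R[2]} := X2 - (2^-1)%:MP.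
Definition l_Gamma : {mpoly R[2]} := 1 - X1 * X2.
Definition l_BC : {mpoly R[2]} := (5 / 2)%:MP - X1 - X2.

Definition f_ (u : R) : {mpoly R[2]} :=
  l_AB * (2%:MP - X1) + u ^+ 2 *: (l_AC * (2%:MP - X2))
    - (4 * u) *: (l_AB * l_AC).

Definition alpha_ (v w : R) : R := (16 * (2 - w) ^+ 2) / (9 * (2 - v) ^+ 2).

Definition beta_ (v w : R) : R := 4 * w - 5 + 3 * (1 - v) * alpha_ v w.

Definition g1_ (v w : R) : {mpoly R[2]} :=
  alpha_ v w *: (X1 + (v / 2) *: X2 - v%:MP - (2^-1)%:MP) ^+ 2
    + (alpha_ v w - 1) *: f_ v + beta_ v w *: l_Gamma.

Definition g2_ (v w : R) : {mpoly R[2]} := g1_ v w \mPo [tuple X2; X1].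

Inductive generator : {mpoly R[2]} -> Prop :=
| gen_square (l : {mpoly R[2]}) of
    l != 0 & (msize l <= 2)%N &
    (exists x y : 'rV[R]_2, [/\ region x, region y, x != y,
                                l.@[x 0] = 0 & l.@[y 0] = 0]) :
    generator (l ^+ 2)
| gen_AB_BC : generator (l_AB * l_BC)
| gen_AC_BC : generator (l_AC * l_BC)
| gen_AB_AC : generator (l_AB * l_AC)
| gen_Gamma : generator l_Gamma
| gen_f (u : R) of 2^-1 <= u & u <= 2 : generator (f_ u)
| gen_g1 (v w : R) of 2^-1 <= v & v < 2 & 2^-1 <= w & w < (2 + 3 * v) / 4 :
    generator (g1_ v w)
| gen_g2 (v w : R) of 2^-1 <= v & v < 2 & 2^-1 <= w & w < (2 + 3 * v) / 4 :
    generator (g2_ v w).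

End Quadratics.

(* Main.v *)
Require Import Defs.
From mathcomp Require Import all_boot all_order all_algebra.
From mathcomp Require Import boolp classical_sets reals ring lra.
From mathcomp Require topology normedtype.

(* Every q that is nonnegative on G is written explicitly as a nonnegative combination
   of generators, so an extreme q is a multiple of one term of such a combination.

   Decomposition.  Subtract from q the largest multiple of l_Gamma that keeps it
   nonnegative.  By compactness q then has a zero where it is critical, or a double
   zero along AC (or AB), or a zero at A.  At a critical zero other than a corner, q is
   a semidefinite form, hence a sum of squares of lines that meet G twice.  In the
   other cases subtract the largest multiple of l_AB l_AC; unless q becomes critical
   again, it touches Gamma at some (v,1/v).  A quadratic with a double zero at (w,1/2)
   along AC that touches Gamma at (v,1/v) has the form d l^2 + n l_AC t, where l is the
   line through the two points and t the tangent to Gamma, and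
     g1_{v,w} = l^2 - (2+3v-4w)^2 / (3 (2-v)^2) l_AC t
   is the member of this pencil that vanishes at B.  The quadratics that vanish at A and
   touch Gamma at (v,1/v) form a cone over the quadrilateral with vertices f_v,
   g1_{v,1/2}, l^2 and g2_{1/v,1/2} (with l_AB l_BC in place of g2 when v = 1/2).

   Extremality.  If q = q1 + q2, the zeros of q, and the derivatives of q that vanish
   although they are nonnegative on the cone, are inherited by q1 and q2; these linear
   conditions determine q1 up to a factor. *)

Set Implicit Arguments.
Unset Strict Implicit.
Unset Printing Implicit Defensive.

Import Order.TTheory GRing.Theory Num.Theory.
Local Open Scope classical_set_scope.
Local Open Scope ring_scope.

(** * Compactness: cluster points in a square *)

Section Compactness.
Import topology normedtype numFieldNormedType.Exports.

(** Monotonicity in e turns the sets [S e] inside the compact square into a proper filter base,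
    which has a cluster point. It is applied to the points where q < e p. *)
Lemma square_cluster (R : realType) (a b : R) (S : R -> R -> R -> Prop) :
  (forall e e' x y, e <= e' -> S e x y -> S e' x y) ->
  (forall e, 0 < e ->
     exists x y, [/\ a <= x <= b, a <= y <= b & S e x y]) ->
  exists x0 y0, [/\ a <= x0 <= b, a <= y0 <= b &
    forall e d, 0 < e -> 0 < d ->
      exists x y, [/\ `|x - x0| < d, `|y - y0| < d & S e x y]].
Proof.
move=> Smono Sex.
set K : set (R * R) := `[a, b] `*` `[a, b].
pose B e : set (R * R) := K `&` [set z | S e z.1 z.2].
have cK : compact K by apply: compact_setX; exact: segment_compact.
have FF : ProperFilter (filter_from [set e : R | 0 < e] B).
  apply: filter_from_proper => [|e /Sex[x [y [xab yab Sxy]]]]; last first.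
    by exists (x, y); split => //; split; rewrite /= in_itv.
  apply: filter_from_filter; first by exists 1 => /=; rewrite ltr01.
  move=> e e' e0 e'0; exists (Num.min e e'); first by rewrite /= lt_min e0.
  move=> z [Kz Sz]; split; split=> //; apply: Smono Sz.
    by rewrite ge_min lexx.
  by rewrite ge_min lexx orbT.
have FK : filter_from [set e : R | 0 < e] B K.
  by exists 1 => /=; [rewrite ltr01|move=> z []].
have [[x0 y0] [[/= xab yab] cl]] := cK _ FF FK.
exists x0, y0; split; [by move: xab; rewrite in_itv|by move: yab; rewrite in_itv|].
move=> e d e0 d0.
have BN : filter_from [set e : R | 0 < e] B (B e) by exists e.
have NN : nbhs (x0, y0) (ball (x0, y0) d) by apply: nbhsx_ballx.
have [[x y] [[_ Sxy] [/= bx by_]]] := cl _ _ BN NN.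
by exists x, y; split => //; rewrite distrC.
Qed.

End Compactness.

From mathcomp Require Import mpoly.

(** * Quadratics on the region *)

Section SmallParameters.
Variable R : realType.
Implicit Types (A B C : R) (P Q : R -> Prop).

Definition for_small P := exists2 s0 : R, 0 < s0 & forall s, 0 < s <= s0 -> P s.

Lemma for_smallS P Q : (forall s, 0 < s -> P s -> Q s) ->
  for_small P -> for_small Q.
Proof.
by move=> PQ [s0 s00 H]; exists s0 => // s /andP[s1 s2]; apply: PQ => //;
  apply: H; rewrite s1.
Qed.

Lemma for_smallT P : (forall s, 0 < s -> P s) -> for_small P.
Proof. by move=> H; exists 1 => // s /andP[s1 s2]; exact: H. Qed.

Lemma for_smallI P Q : for_small P -> for_small Q ->
  for_small (fun s => P s /\ Q s).
Proof.
move=> [s0 s00 H] [s1 s10 H1]; exists (Num.min s0 s1); first by rewrite lt_min s00.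
move=> s /andP[s2]; rewrite le_min => /andP[s3 s4].
by split; [apply: H|apply: H1]; rewrite s2.
Qed.

Lemma for_small_ex P : for_small P -> exists2 s, 0 < s & P s.
Proof. by move=> [s s0 H]; exists s => //; apply: H; rewrite s0 lexx. Qed.

Lemma for_small_le A : 0 < A -> for_small (fun s => s <= A).
Proof. by move=> A0; exists A => // s /andP[]. Qed.

Lemma for_small_lin A B : 0 < A -> for_small (fun s => 0 <= A + s * B).
Proof.
move=> A0; have [B0|B0] := leP 0 B.
  by apply: for_smallT => s s0; have := mulr_ge0 (ltW s0) B0; lra.
have AB : 0 < A / - B by rewrite divr_gt0 // oppr_gt0.
apply: for_smallS (for_small_le AB) => s s0.
by rewrite ler_pdivlMr ?oppr_gt0//; lra.
Qed.

Lemma for_small_quad A B C : 0 < A ->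
  for_small (fun s => 0 <= A + s * B + s ^+ 2 * C).
Proof.
move=> A0.
apply: for_smallS (for_smallI (for_small_lin B (_ : 0 < A / 2))
  (for_smallI (for_small_lin C (_ : 0 < A / 2)) (for_small_le ltr01)));
  try by lra.
move=> s s0 [H1 [H2 H3]]; have [C0|C0] := leP 0 C.
  by have := mulr_ge0 (sqr_ge0 s) C0; lra.
have : 0 <= s * (1 - s) by apply: mulr_ge0; lra.
by nra.
Qed.

(** If A < 0, then also - A / 2 - s B >= 0 for small s, and adding the two inequalities gives A / 2
    >= 0. *)
Lemma for_small_ge0 A B : for_small (fun s => 0 <= A + s * B) -> 0 <= A.
Proof.
move=> H; have [//|A0] := leP 0 A.
have NA : 0 < - A / 2 by lra.
have [s s0 [H1 H2]] := for_small_ex (for_smallI H (for_small_lin (- B) NA)).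
lra.
Qed.

Lemma for_small_quad_ge0 A B C :
  for_small (fun s => 0 <= A + s * B + s ^+ 2 * C) -> 0 <= A.
Proof.
move=> H; have [//|A0] := leP 0 A.
have NA : 0 < - A / 2 by lra.
have [s s0 [H1 H2]] := for_small_ex (for_smallI H (for_small_quad (- B) (- C) NA)).
lra.
Qed.

End SmallParameters.

(** * Quadratics by coefficients and admissible directions in G *)

Section Quad.
Variable R : realType.

(** Bare coefficients, so that relations between quadratics become goals for [field], [lra] or
    [nra]; [to_mpoly] leads back to polynomials. *)
Record quad := Quad { k00 : R; k10 : R; k01 : R; k20 : R; k11 : R; k02 : R }.

Definition ev (q : quad) (x y : R) : R :=
  k00 q + k10 q * x + k01 q * y + k20 q * x ^+ 2 + k11 q * (x * y)
  + k02 q * y ^+ 2.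
Local Coercion ev : quad >-> Funclass.

Definition qdx (q : quad) (x y : R) : R := k10 q + 2 * k20 q * x + k11 q * y.
Definition qdy (q : quad) (x y : R) : R := k01 q + k11 q * x + 2 * k02 q * y.

Definition swapq (q : quad) : quad :=
  Quad (k00 q) (k01 q) (k10 q) (k02 q) (k11 q) (k20 q).

Definition qsub (q : quad) (l : R) (p : quad) : quad :=
  Quad (k00 q - l * k00 p) (k10 q - l * k10 p) (k01 q - l * k01 p)
       (k20 q - l * k20 p) (k11 q - l * k11 p) (k02 q - l * k02 p).

Definition inG (x y : R) : Prop := [/\ 2^-1 <= x, 2^-1 <= y & x * y <= 1].

Definition posG (q : quad) : Prop := forall x y, inG x y -> 0 <= q x y.

Implicit Types (q p : quad) (x y z t u v l e : R).

Lemma swapqE q x y : swapq q x y = q y x.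
Proof. by rewrite /ev /=; ring. Qed.

Lemma swapqK : involutive swapq. Proof. by case. Qed.

Lemma qsubE q l p x y : qsub q l p x y = q x y - l * p x y.
Proof. by rewrite /ev /=; ring. Qed.

Lemma inG_sym x y : inG x y -> inG y x.
Proof. by case=> *; split => //; rewrite mulrC. Qed.

Lemma posG_swap q : posG q -> posG (swapq q).
Proof. by move=> H x y /inG_sym/H; rewrite swapqE. Qed.

Lemma qdx_swap q x y : qdx (swapq q) x y = qdy q y x.
Proof. by rewrite /qdx /qdy /=; ring. Qed.

Lemma qdy_swap q x y : qdy (swapq q) x y = qdx q y x.
Proof. by rewrite /qdx /qdy /=; ring. Qed.

Lemma quadD q x y u v : q (x + u) (y + v) =
  q x y + (qdx q x y * u + qdy q x y * v)
  + (k20 q * u ^+ 2 + k11 q * (u * v) + k02 q * v ^+ 2).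
Proof. by rewrite /ev /qdx /qdy; ring. Qed.

Lemma inG_le2 x y : inG x y -> x <= 2 /\ y <= 2.
Proof. by move=> [? ? ?]; split; nra. Qed.

Lemma inG_Gamma x : 2^-1 <= x -> x <= 2 -> inG x x^-1.
Proof.
move=> x1 x2; have x0 : 0 < x by lra.
split => //; last by rewrite divff ?gt_eqF.
by rewrite lef_pV2 ?posrE.
Qed.

Lemma quad_near q x0 y0 e : 0 < e -> exists2 d, 0 < d &
  forall x y, `|x - x0| < d -> `|y - y0| < d -> `|q x y - q x0 y0| < e.
Proof.
move=> e0.
(* M serves as a Lipschitz constant at distance at most 1: each Taylor term is at most max(|u|,|v|)
   times its coefficient. *)
pose M := `|qdx q x0 y0| + `|qdy q x0 y0| + `|k20 q| + `|k11 q| + `|k02 q| + 1.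
have M0 : 0 < M by rewrite ltr_wpDl // !addr_ge0.
exists (Num.min 1 (e / M)); first by rewrite lt_min ltr01 divr_gt0.
move=> x y; rewrite !lt_min => /andP[x1 xe] /andP[y1 ye].
have -> : q x y = q (x0 + (x - x0)) (y0 + (y - y0)) by congr (ev q); ring.
rewrite quadD; move: x1 xe y1 ye; move: (x - x0) (y - y0) => u v.
move=> u1 ue v1 ve.
pose m := Num.max `|u| `|v|.
have um : `|u| <= m by rewrite le_max lexx.
have vm : `|v| <= m by rewrite le_max lexx orbT.
have m0 : 0 <= m by apply: le_trans um.
have m1 : m <= 1 by rewrite ge_max !ltW.
have me : m < e / M by rewrite gt_max ue.
clearbody m.
have mM : m * M < e by rewrite -ltr_pdivlMr.
have E (a b c : R) : a + b + c - a = b + c by ring.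
rewrite E.
apply: le_lt_trans mM.
have u0 := normr_ge0 u; have v0 := normr_ge0 v.
have uu : `|u ^+ 2| <= m by rewrite normrX; nra.
have vv : `|v ^+ 2| <= m by rewrite normrX; nra.
have uv : `|u * v| <= m.
  by rewrite normrM; nra.
have T a b : `|b| <= m -> `|a * b| <= m * `|a|.
  by move=> H; rewrite normrM mulrC ler_wpM2r.
rewrite /M !mulrDr mulr1.
have := T (qdx q x0 y0) u um; have := T (qdy q x0 y0) v vm.
have := T (k20 q) _ uu; have := T (k11 q) _ uv; have := T (k02 q) _ vv.
have := ler_normD (k20 q * u ^+ 2 + k11 q * (u * v)) (k02 q * v ^+ 2).
have := ler_normD (k20 q * u ^+ 2) (k11 q * (u * v)).
have := ler_normD (qdx q x0 y0 * u) (qdy q x0 y0 * v).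
have := ler_normD (qdx q x0 y0 * u + qdy q x0 y0 * v)
  (k20 q * u ^+ 2 + k11 q * (u * v) + k02 q * v ^+ 2).
by lra.
Qed.

(** Each hypothesis preserves one active constraint. The product x y changes by s (u y + v x) + s^2
    u v, so a direction tangent to Gamma is admissible when u v <= 0. *)
Lemma inG_small x y u v : inG x y ->
  (x = 2^-1 -> 0 <= u) -> (y = 2^-1 -> 0 <= v) ->
  (x * y = 1 -> u * y + v * x < 0 \/ (u * y + v * x = 0 /\ u * v <= 0)) ->
  for_small (fun s => inG (x + s * u) (y + s * v)).
Proof.
move=> [x1 y1 xy] Hx Hy Hxy.
have S (z w : R) : 2^-1 <= z -> (z = 2^-1 -> 0 <= w) ->
    for_small (fun s => 2^-1 <= z + s * w).
  move=> z1 zw; move: z1; rewrite le_eqVlt => /orP[/eqP z1|z1].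
    by apply: for_smallT => s s0; have := mulr_ge0 (ltW s0) (zw (esym z1)); lra.
  apply: for_smallS (for_small_lin w (_ : 0 < z - 2^-1)); last by lra.
  by move=> s s0; lra.
have T : for_small (fun s => (x + s * u) * (y + s * v) <= 1).
  have E s : (x + s * u) * (y + s * v) =
    x * y + s * (u * y + v * x) + s ^+ 2 * (u * v) by ring.
  move: xy; rewrite le_eqVlt => /orP[/eqP xy|xy].
    have [g0|[g0 uv]] := Hxy xy.
      apply: for_smallS (for_small_lin (- (u * v)) (_ : 0 < - (u * y + v * x)));
        last by lra.
      move=> s s0 H; rewrite E xy.
      by have := mulr_ge0 (ltW s0) H; lra.
    apply: for_smallT => s s0; rewrite E xy g0 mulr0 addr0.
    by have := sqr_ge0 s; nra.
  apply: for_smallS (for_small_quad (- (u * y + v * x)) (- (u * v))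
    (_ : 0 < 1 - x * y)); last by lra.
  by move=> s s0; rewrite E; lra.
apply: for_smallS (for_smallI (S x u x1 Hx) (for_smallI (S y v y1 Hy) T)).
by move=> s s0 [? [? ?]]; split.
Qed.

Lemma dir_ge0 q x y u v : posG q -> q x y = 0 ->
  for_small (fun s => inG (x + s * u) (y + s * v)) ->
  0 <= qdx q x y * u + qdy q x y * v.
Proof.
move=> qG q0 H.
apply: (@for_small_ge0 _ _ (k20 q * u ^+ 2 + k11 q * (u * v) + k02 q * v ^+ 2)).
apply: for_smallS H => s s0 /qG; rewrite quadD q0 => H.
rewrite -(pmulr_rge0 _ s0); apply: le_trans H _.
by rewrite le_eqVlt; apply/orP; left; apply/eqP; ring.
Qed.

(* Every segment from G to the square [1/2, 3/4]^2 stays in G, because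
   x + y <= 5/2 on G. *)
Lemma grad_ge0 q x y z t : posG q -> inG x y -> q x y = 0 ->
  2^-1 <= z <= 3 / 4 -> 2^-1 <= t <= 3 / 4 ->
  0 <= qdx q x y * (z - x) + qdy q x y * (t - y).
Proof.
move=> qG [x1 y1 xy] q0 /andP[z1 z2] /andP[t1 t2].
apply: dir_ge0 => //; exists 1 => // s /andP[s0 s1].
have c0 : 0 <= 1 - s by lra.
have s0' := ltW s0.
have E (a b : R) : a + s * (b - a) = (1 - s) * a + s * b by ring.
rewrite !E; split.
- by have := ler_wpM2l c0 x1; have := ler_wpM2l s0' z1; lra.
- by have := ler_wpM2l c0 y1; have := ler_wpM2l s0' t1; lra.
have S : x + y <= 5 / 2 by nra.
have XT : x * t + z * y <= 2 by nra.
have ZT : z * t <= 1 by nra.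
have -> : ((1 - s) * x + s * z) * ((1 - s) * y + s * t) =
  (1 - s) ^+ 2 * (x * y) + s * (1 - s) * (x * t + z * y) + s ^+ 2 * (z * t) by ring.
have := ler_wpM2l (sqr_ge0 (1 - s)) xy.
have := ler_wpM2l (mulr_ge0 s0' c0) XT.
have := ler_wpM2l (sqr_ge0 s) ZT.
have -> : (1 - s) ^+ 2 = 1 - 2 * s + s ^+ 2 by ring.
lra.
Qed.

(** The expression is affine in (z,t) and vanishes at three corners of the square, so its linear
    coefficients vanish. *)
Lemma grad_eq0 q x y :
  (forall z t, 2^-1 <= z <= 3 / 4 -> 2^-1 <= t <= 3 / 4 ->
     qdx q x y * (z - x) + qdy q x y * (t - y) = 0) ->
  qdx q x y = 0 /\ qdy q x y = 0.
Proof.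
move=> H.
have := H 2^-1 2^-1; have := H (3 / 4) 2^-1; have := H 2^-1 (3 / 4).
by have -> : 2^-1 <= 2^-1 :> R; [lra|]; have -> : (2^-1 <= (3 / 4 : R) <= 3 / 4);
  [lra|]; have -> : 2^-1 <= (3 / 4 : R); [lra|]; rewrite /= => /(_ isT isT) a /(_ isT isT) b
  /(_ isT isT) c; split; lra.
Qed.

(** The vertices A, B, C in this order; a line through one of them can meet G in that point
    alone. *)
Definition corner (x y : R) :=
  [\/ x = 2^-1 /\ y = 2^-1, x = 2^-1 /\ y = 2 | x = 2 /\ y = 2^-1].

(** Away from the corners at most one constraint is active, so (u,v) or its opposite is admissible;
    along a tangent to Gamma, x y <= 1 holds in both senses. *)
Lemma line_meets_G x y u v : inG x y -> ~ corner x y -> ((u != 0) || (v != 0)) ->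
  exists2 s, s != 0 & inG (x + s * u) (y + s * v).
Proof.
move=> xyG nc uv0; have [x1 y1 xy] := xyG.
have [sg sg0 H] : exists2 sg : R, sg != 0 &
    for_small (fun s => inG (x + s * (sg * u)) (y + s * (sg * v))).
  have [xh|xh] := eqVneq x 2^-1.
    exists (if 0 <= u then 1 else -1); first by case: ifP; rewrite ?oppr_eq0 oner_eq0.
    apply: inG_small => // [_|yh|xy1].
    - by case: ifP; [rewrite mul1r|move=> /negbT; rewrite -ltNge mulN1r; lra].
    - by case: nc; apply: Or31.
    - by case: nc; apply: Or32; split=> //; move: xy1; rewrite xh; lra.
  have [yh|yh] := eqVneq y 2^-1.
    exists (if 0 <= v then 1 else -1); first by case: ifP; rewrite ?oppr_eq0 oner_eq0.
    apply: inG_small => // [xh'|_|xy1].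
    - by rewrite xh' eqxx in xh.
    - by case: ifP; [rewrite mul1r|move=> /negbT; rewrite -ltNge mulN1r; lra].
    - by case: nc; apply: Or33; split=> //; move: xy1; rewrite yh; lra.
  have [g0|g0] := leP (u * y + v * x) 0; [exists 1|exists (-1)];
    rewrite ?oppr_eq0 ?oner_eq0 //; (apply: inG_small => // [/eqP|/eqP|xy1];
      rewrite ?(negbTE xh) ?(negbTE yh) //).
  - rewrite !mul1r; move: g0; rewrite le_eqVlt => /orP[/eqP g0|]; [right|by left].
    split=> //; have U : u * y = - (v * x) by lra.
    have : u * v * (x * y) = (u * y) * (v * x) by ring.
    by rewrite xy1 U mulr1 => ->; rewrite mulNr oppr_le0 -expr2 sqr_ge0.
  - by left; lra.
have [s s0 Hs] := for_small_ex H.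
by exists (s * sg); [rewrite mulf_neq0 // gt_eqF|rewrite -!mulrA].
Qed.

End Quad.

(** * Coefficients of quadratic polynomials *)

Section Bridge.
Variable R : realType.
Local Coercion ev : quad >-> Funclass.
Implicit Types (p : {mpoly R[2]}) (q : quad R) (x y c : R).

Definition pt x y : 'rV[R]_2 := \row_i (if i == 0 then x else y).

Definition evm p x y : R := p.@[pt x y 0].

Lemma pt0 x y : pt x y 0 0 = x. Proof. by rewrite mxE. Qed.
Lemma pt1 x y : pt x y 0 1 = y. Proof. by rewrite mxE. Qed.

Lemma ptK (z : 'rV[R]_2) : pt (z 0 0) (z 0 1) = z.
Proof.
apply/rowP => i; rewrite mxE; case: i => [[|[|//]] Hi]; rewrite /=;
  by congr (z 0 _); apply: val_inj.
Qed.

Lemma evmX1 x y : evm (X1 R) x y = x.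
Proof. by rewrite /evm mevalXU pt0. Qed.
Lemma evmX2 x y : evm (X2 R) x y = y.
Proof. by rewrite /evm mevalXU pt1. Qed.
Lemma evmC c x y : evm c%:MP x y = c. Proof. exact: mevalC. Qed.
Lemma evm0 x y : evm 0 x y = 0. Proof. exact: meval0. Qed.
Lemma evm1 x y : evm 1 x y = 1. Proof. exact: meval1. Qed.
Lemma evmD p p' x y : evm (p + p') x y = evm p x y + evm p' x y.
Proof. exact: mevalD. Qed.
Lemma evmN p x y : evm (- p) x y = - evm p x y.
Proof. exact: mevalN. Qed.
Lemma evmM p p' x y : evm (p * p') x y = evm p x y * evm p' x y.
Proof. exact: mevalM. Qed.
Lemma evmZ c p x y : evm (c *: p) x y = c * evm p x y.
Proof. exact: mevalZ. Qed.
Lemma evmXn p n x y : evm (p ^+ n) x y = evm p x y ^+ n.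
Proof. exact: rmorphXn. Qed.

Definition evmE := (evmX1, evmX2, evmC, evm0, evm1, evmD, evmN, evmM, evmZ, evmXn).

Lemma regionE x y : region (pt x y) <-> inG x y.
Proof.
split=> [[/= H]|H].
  rewrite pt0 pt1 => xy; split=> //.
    by have /andP[] := H 0; rewrite pt0.
  by have /andP[] := H 1; rewrite pt1.
have [x2 y2] := inG_le2 H; have [x1 y1 xy] := H.
split=> /=; last by rewrite pt0 pt1.
by move=> i; rewrite mxE; case: ifP => _; apply/andP.
Qed.

Definition to_mpoly q : {mpoly R[2]} :=
  (k00 q)%:MP + k10 q *: X1 R + k01 q *: X2 R + k20 q *: X1 R ^+ 2
  + k11 q *: (X1 R * X2 R) + k02 q *: X2 R ^+ 2.

Lemma evm_to_mpoly q x y : evm (to_mpoly q) x y = q x y.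
Proof. by rewrite /to_mpoly !evmE. Qed.

Lemma msize_to_mpoly q : (msize (to_mpoly q) <= 3)%N.
Proof.
have S1 : msize (X1 R) = 2 by rewrite msizeX mdeg1.
have S2 : msize (X2 R) = 2 by rewrite msizeX mdeg1.
have M (p p' : {mpoly R[2]}) : msize p = 2 -> msize p' = 2 -> (msize (p * p') <= 3)%N.
  by move=> H H'; rewrite msizeM ?H ?H' // -msize_poly_eq0 ?H ?H'.
have D (p p' : {mpoly R[2]}) :
    (msize p <= 3)%N -> (msize p' <= 3)%N -> (msize (p + p') <= 3)%N.
  by move=> H H'; apply: leq_trans (msizeD_le _ _ ) _; rewrite geq_max H.
have Z c p : (msize p <= 3)%N -> (msize (c *: p) <= 3)%N.
  by apply: leq_trans; exact: msizeZ_le.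
rewrite /to_mpoly; do ?apply: (D); rewrite ?Z ?M ?S1 ?S2 // msizeC.
by case: eqP.
Qed.

(** Reduces a property stable under linear combinations to finitely many monomials; it yields the
    coefficient forms [to_mpoly] and [affine]. *)
Lemma msize_ind (P : {mpoly R[2]} -> Prop) k :
  P 0 -> (forall p p', P p -> P p' -> P (p + p')) ->
  (forall c p, P p -> P (c *: p)) ->
  (forall i j, (i + j < k)%N -> P (X1 R ^+ i * X2 R ^+ j)) ->
  forall p, (msize p <= k)%N -> P p.
Proof.
move=> P0 PD PZ PX p pk.
rewrite [p]mpolyE big_seq; apply: big_ind => // m /msize_mdeg_lt/leq_trans/(_ pk) mk.
apply: PZ; rewrite mpolyXE_id !big_ord_recl big_ord0 mulr1.
have E : lift 0 ord0 = 1 :> 'I_2 by apply: val_inj.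
rewrite E; apply: PX.
by move: mk; rewrite mdegE !big_ord_recl big_ord0 addn0 E.
Qed.

Lemma to_mpolyP p : (msize p <= 3)%N -> exists q, p = to_mpoly q.
Proof.
move: p; apply: msize_ind.
- by exists (Quad 0 0 0 0 0 0); rewrite /to_mpoly /= -!mul_mpolyC; ring.
- move=> _ _ [q ->] [q' ->].
  exists (Quad (k00 q + k00 q') (k10 q + k10 q') (k01 q + k01 q')
               (k20 q + k20 q') (k11 q + k11 q') (k02 q + k02 q')).
  by rewrite /to_mpoly /= -!mul_mpolyC; ring.
- move=> c _ [q ->].
  exists (Quad (c * k00 q) (c * k10 q) (c * k01 q)
               (c * k20 q) (c * k11 q) (c * k02 q)).
  by rewrite /to_mpoly /= -!mul_mpolyC; ring.
case=> [|[|[|//]]]; case=> [|[|[|//]]] // _.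
- by exists (Quad 1 0 0 0 0 0); rewrite /to_mpoly /= -!mul_mpolyC; ring.
- by exists (Quad 0 0 1 0 0 0); rewrite /to_mpoly /= -!mul_mpolyC; ring.
- by exists (Quad 0 0 0 0 0 1); rewrite /to_mpoly /= -!mul_mpolyC; ring.
- by exists (Quad 0 1 0 0 0 0); rewrite /to_mpoly /= -!mul_mpolyC; ring.
- by exists (Quad 0 0 0 0 1 0); rewrite /to_mpoly /= -!mul_mpolyC; ring.
- by exists (Quad 0 0 0 1 0 0); rewrite /to_mpoly /= -!mul_mpolyC; ring.
Qed.

Definition affine a b c : {mpoly R[2]} := a%:MP + b *: X1 R + c *: X2 R.

Lemma evm_affine a b c x y : evm (affine a b c) x y = a + b * x + c * y.
Proof. by rewrite !evmE. Qed.

Lemma affineP p : (msize p <= 2)%N -> exists a b c, p = affine a b c.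
Proof.
move: p; apply: msize_ind.
- by exists 0, 0, 0; rewrite /affine -!mul_mpolyC; ring.
- move=> _ _ [a [b [c ->]]] [a' [b' [c' ->]]].
  by exists (a + a'), (b + b'), (c + c'); rewrite /affine -!mul_mpolyC; ring.
- move=> d _ [a [b [c ->]]].
  by exists (d * a), (d * b), (d * c); rewrite /affine -!mul_mpolyC; ring.
case=> [|[|//]]; case=> [|[|//]] // _.
- by exists 1, 0, 0; rewrite /affine -!mul_mpolyC; ring.
- by exists 0, 0, 1; rewrite /affine -!mul_mpolyC; ring.
- by exists 0, 1, 0; rewrite /affine -!mul_mpolyC; ring.
Qed.

Lemma msize_affine a b c : (msize (affine a b c) <= 2)%N.
Proof.
have D (p p' : {mpoly R[2]}) :
    (msize p <= 2)%N -> (msize p' <= 2)%N -> (msize (p + p') <= 2)%N.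
  by move=> H H'; apply: leq_trans (msizeD_le _ _ ) _; rewrite geq_max H.
rewrite /affine; do ?apply: (D);
  rewrite ?(leq_trans (msizeZ_le _ _)) ?msizeX ?mdeg1 // msizeC.
by case: eqP.
Qed.

Lemma ev_inj q q' : (forall x y, q x y = q' x y) -> q = q'.
Proof.
case: q q' => [a b c d e f] [a' b' c' d' e' f'] H.
have := H 0 0; have := H 1 0; have := H 0 1; have := H 1 1;
  have := H (-1) 0; have := H 0 (-1); rewrite /ev /= => *.
by congr Quad; lra.
Qed.

Lemma evm_inj p p' : (msize p <= 3)%N -> (msize p' <= 3)%N ->
  (forall x y, evm p x y = evm p' x y) -> p = p'.
Proof.
move=> /to_mpolyP[q ->] /to_mpolyP[q' ->] H; congr to_mpoly; apply: ev_inj.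
by move=> x y; rewrite -!evm_to_mpoly.
Qed.

Lemma nonneg_quadraticsP p : nonneg_quadratics (@region R) p <->
  exists2 q, p = to_mpoly q & posG q.
Proof.
split=> [[/to_mpolyP[q ->] H]|[q -> H]].
  exists q => // x y /regionE/H; by rewrite -/(evm _ _ _) evm_to_mpoly.
split=> [|z zG]; first exact: msize_to_mpoly.
rewrite -(ptK z) in zG *; rewrite -/(evm _ _ _) evm_to_mpoly.
by apply: H; exact/regionE.
Qed.

End Bridge.

(** * The cone spanned by the generators *)

Section Cone.
Variable R : realType.
Local Coercion ev : quad >-> Funclass.
Implicit Types (p : {mpoly R[2]}) (q : quad R) (x y c u v w : R) (f : R -> R -> R).

Definition ffun u x y : R :=
  (x - 2^-1) * (2 - x) + u ^+ 2 * ((y - 2^-1) * (2 - y))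
  - 4 * u * ((x - 2^-1) * (y - 2^-1)).

Definition gfun v w x y : R :=
  alpha_ v w * (x + v / 2 * y - v - 2^-1) ^+ 2
  + (alpha_ v w - 1) * ffun v x y + beta_ v w * (1 - x * y).

Lemma evm_f u x y : evm (f_ u) x y = ffun u x y.
Proof. by rewrite /f_ /l_AB /l_AC !evmE /ffun. Qed.

Lemma evm_g1 v w x y : evm (g1_ v w) x y = gfun v w x y.
Proof. by rewrite /g1_ !evmE. Qed.

Lemma evm_comp p x y : evm (p \mPo [tuple X2 R; X1 R]) x y = evm p y x.
Proof.
rewrite /evm comp_mpoly_meval; apply: meval_eq => i; rewrite mxE.
by case: i => [[|[|//]] Hi]; rewrite (tnth_nth 0) /= -/(evm _ _ _) evmE.
Qed.

Lemma evm_g2 v w x y : evm (g2_ v w) x y = gfun v w y x.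
Proof. by rewrite /g2_ evm_comp evm_g1. Qed.

Definition hull : set {mpoly R[2]} :=
  conic_hull (\bigcup_(q in @generator R) ray q).

(** Phrased for functions of two real variables, so that a decomposition is checked pointwise by
    [ring] or [field]. *)
Definition cone f : Prop := exists2 p, hull p & forall x y, f x y = evm p x y.

Lemma hull0 : hull 0.
Proof.
exists 0%N, (fun _ => 0), (fun _ => 0); split; try by case.
by rewrite big_ord0.
Qed.

Lemma hullD p p' : hull p -> hull p' -> hull (p + p').
Proof.
move=> [n [c [P [c0 SP ->]]]] [n' [c' [P' [c0' SP' ->]]]].
exists (n + n')%N,
  (fun i => match split i with inl j => c j | inr j => c' j end),
  (fun i => match split i with inl j => P j | inr j => P' j end).
split=> [i|i|]; [by case: split|by case: split|].
rewrite big_split_ord /=; congr (_ + _); apply: eq_bigr => i _.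
  by rewrite -[lshift n' i]/(unsplit (inl i)) unsplitK.
by rewrite -[rshift n i]/(unsplit (inr i)) unsplitK.
Qed.

Lemma hullZ c p : 0 <= c -> hull p -> hull (c *: p).
Proof.
move=> c0 [n [d [P [d0 SP ->]]]]; exists n, (fun i => c * d i), P.
split=> [i||]; [exact: mulr_ge0|exact: SP|].
by rewrite scaler_sumr; apply: eq_bigr => i _; rewrite scalerA.
Qed.

Lemma hull_gen p : generator p -> hull p.
Proof.
move=> gp; exists 1%N, (fun=> 1), (fun=> p); split=> [_|_|]; first exact: ler01.
  by exists p => //; exists 1; rewrite ?scale1r //= ler01.
by rewrite big_ord1 scale1r.
Qed.

Lemma cone_ext f g : (forall x y, f x y = g x y) -> cone g -> cone f.
Proof. by move=> fg [p hp H]; exists p => // x y; rewrite fg. Qed.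

Lemma coneD f g : cone f -> cone g -> cone (fun x y => f x y + g x y).
Proof.
move=> [p hp H] [p' hp' H']; exists (p + p'); first exact: hullD.
by move=> x y; rewrite evmD H H'.
Qed.

Lemma coneZ c f : 0 <= c -> cone f -> cone (fun x y => c * f x y).
Proof.
move=> c0 [p hp H]; exists (c *: p); first exact: hullZ.
by move=> x y; rewrite evmZ H.
Qed.

Lemma cone0 : cone (fun _ _ => 0).
Proof. by exists 0; [exact: hull0|move=> x y; rewrite evm0]. Qed.

Lemma cone_gen p : generator p -> cone (evm p).
Proof. by move=> gp; exists p => //; exact: hull_gen. Qed.

Lemma cone_sq x y s u v : inG x y -> inG (x + s * u) (y + s * v) -> s != 0 ->
  cone (fun a b => (v * (a - x) - u * (b - y)) ^+ 2).
Proof.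
move=> G1 G2 s0.
have [uv0|] := boolP ((u == 0) && (v == 0)).
  apply: cone_ext cone0 => a b; move: uv0 => /andP[/eqP-> /eqP->].
  by rewrite !mul0r subrr expr0n.
move=> uv0; pose l := affine (u * y - v * x) v (- u).
have El a b : evm l a b = v * (a - x) - u * (b - y).
  by rewrite evm_affine; ring.
apply: cone_ext (cone_gen (gen_square (l := l) _ _ _)).
- by move=> a b; rewrite evmXn El.
- apply: contra uv0 => /eqP l0.
  have := El x (y + 1); have := El (x + 1) y; rewrite l0 !evm0 => E1 E2.
  by apply/andP; split; apply/eqP; lra.
- exact: msize_affine.
exists (pt x y), (pt (x + s * u) (y + s * v)).
split; [exact/regionE|exact/regionE| |by rewrite -/(evm _ _ _) El !subrr !mulr0 subrr|].
  apply: contra uv0 => /eqP /rowP E; have := E 0; have := E 1.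
  rewrite !pt0 !pt1 => E1 E2; apply/andP; split; apply/eqP.
    by apply/(mulfI s0); lra.
  by apply/(mulfI s0); lra.
by rewrite -/(evm _ _ _) El; ring.
Qed.

Lemma cone_AB_AC : cone (fun x y => (x - 2^-1) * (y - 2^-1)).
Proof.
apply: cone_ext (cone_gen (gen_AB_AC R)) => x y.
by rewrite /l_AB /l_AC !evmE.
Qed.

Lemma cone_AC_BC : cone (fun x y => (y - 2^-1) * (5 / 2 - x - y)).
Proof.
apply: cone_ext (cone_gen (gen_AC_BC R)) => x y.
by rewrite /l_BC /l_AC !evmE.
Qed.

Lemma cone_AB_BC : cone (fun x y => (x - 2^-1) * (5 / 2 - x - y)).
Proof.
apply: cone_ext (cone_gen (gen_AB_BC R)) => x y.
by rewrite /l_BC /l_AB !evmE.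
Qed.

Lemma cone_Gamma : cone (fun x y => 1 - x * y).
Proof.
apply: cone_ext (cone_gen (gen_Gamma R)) => x y.
by rewrite /l_Gamma !evmE.
Qed.

Lemma cone_f u : 2^-1 <= u -> u <= 2 -> cone (ffun u).
Proof.
move=> u1 u2; apply: cone_ext (cone_gen (gen_f u1 u2)) => x y.
by rewrite evm_f.
Qed.

Lemma cone_g v w : 2^-1 <= v -> v < 2 -> 2^-1 <= w -> w < (2 + 3 * v) / 4 ->
  cone (gfun v w).
Proof.
move=> ? ? ? ?; apply: cone_ext (cone_gen (gen_g1 (v := v) (w := w) _ _ _ _)) => //.
by move=> x y; rewrite evm_g1.
Qed.

(** The exchange of coordinates pairs [l_AB * l_BC] with [l_AC * l_BC] and [g1_] with [g2_], and
    turns f_u into u^2 f_{1/u}, whence the factor c. *)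
Lemma gen_swap p : generator p ->
  exists c p', [/\ 0 <= c, generator p' & forall x y, evm p y x = c * evm p' x y].
Proof.
have h1 (x : R) : (1 : R) * x = x by rewrite mul1r.
case=> [l l0 l2 [z [t [zG tG zt lz lt]]]||||||v w v1 v2 w1 w2|v w v1 v2 w1 w2].
- have [a [b [c lE]]] := affineP l2.
  exists 1, (affine a c b ^+ 2); split; first exact: ler01.
    apply: gen_square (msize_affine _ _ _) _.
      apply: contra l0 => /eqP l0; rewrite lE; apply/eqP.
      apply: evm_inj; rewrite ?msize0 ?(leqW (msize_affine _ _ _)) // => x y.
      by have := evm_affine a c b y x; rewrite l0 evm_affine !evm0; lra.
    move: lz lt; rewrite -(ptK z) -(ptK t) -!/(evm _ _ _) lE !evm_affine => lz lt.
    exists (pt (z 0 1) (z 0 0)), (pt (t 0 1) (t 0 0)); split.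
    - by apply/regionE/inG_sym/regionE; rewrite ptK.
    - by apply/regionE/inG_sym/regionE; rewrite ptK.
    - apply: contra zt => /eqP/rowP E; have := E 0; have := E 1.
      by rewrite !pt0 !pt1 => E1 E0; rewrite -(ptK z) -(ptK t) E0 E1.
    - by rewrite -/(evm _ _ _) evm_affine; lra.
    - by rewrite -/(evm _ _ _) evm_affine; lra.
  by move=> x y; rewrite lE !evmE; ring.
- by exists 1, (l_AC R * l_BC R); split; [exact: ler01|exact: gen_AC_BC|
  move=> x y; rewrite /l_AB /l_AC /l_BC !evmE; ring].
- by exists 1, (l_AB R * l_BC R); split; [exact: ler01|exact: gen_AB_BC|
  move=> x y; rewrite /l_AB /l_AC /l_BC !evmE; ring].
- by exists 1, (l_AB R * l_AC R); split; [exact: ler01|exact: gen_AB_AC|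
  move=> x y; rewrite /l_AB /l_AC /l_BC !evmE; ring].
- by exists 1, (l_Gamma R); split; [exact: ler01|exact: gen_Gamma|
  move=> x y; rewrite /l_Gamma !evmE; ring].
- move=> u u1 u2; have u0 : 0 < u by lra.
  have uV : u * u^-1 = 1 by rewrite divff // gt_eqF.
  have V0 : 0 < u^-1 by rewrite invr_gt0.
  exists (u ^+ 2), (f_ u^-1); split; first exact: sqr_ge0.
    by apply: gen_f; nra.
  move=> x y; rewrite !evm_f /ffun; move: (u^-1) uV => t ut.
  transitivity ((u * t) ^+ 2 * ((y - 2^-1) * (2 - y)) + u ^+ 2 * ((x - 2^-1) * (2 - x))
    - 4 * u * (u * t) * ((y - 2^-1) * (x - 2^-1))); last by ring.
  by rewrite ut; ring.
- exists 1, (g2_ v w); split; [exact: ler01|exact: gen_g2|move=> x y].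
  by rewrite evm_g2 evm_g1 mul1r.
- exists 1, (g1_ v w); split; [exact: ler01|exact: gen_g1|move=> x y].
  by rewrite evm_g2 evm_g1 mul1r.
Qed.

Lemma cone_swap f : cone f -> cone (fun x y => f y x).
Proof.
move=> [p [n [c [P [c0 SP ->]]]] H].
suff : cone (fun x y => evm (\sum_(i < n) c i *: P i) y x) by apply: cone_ext => x y; rewrite H.
elim/big_ind: _ => [|p1 p2 C1 C2|i _].
- by apply: cone_ext cone0 => x y; rewrite evm0.
- by apply: cone_ext (coneD C1 C2) => x y; rewrite evmD.
have [p' /gen_swap[d [r [d0 gr E]]] [e /= e0 <-]] := SP i.
apply: cone_ext (coneZ (mulr_ge0 (mulr_ge0 (c0 i) e0) d0) (cone_gen gr)) => x y.
by rewrite !evmZ E !mulrA.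
Qed.

End Cone.

(** * Maximal subtraction and the zeros it produces *)

Section Stuck.
Variable R : realType.
Local Coercion ev : quad >-> Funclass.
Implicit Types (p q r : quad R) (x y c u v w : R).

Lemma eq_ge0 (a b : R) : a = b -> 0 <= a -> 0 <= b.
Proof. by move=> ->. Qed.

Lemma posG_dir q x y u v : posG q -> inG x y -> q x y = 0 ->
  (x = 2^-1 -> 0 <= u) -> (y = 2^-1 -> 0 <= v) ->
  (x * y = 1 -> u * y + v * x < 0 \/ (u * y + v * x = 0 /\ u * v <= 0)) ->
  0 <= qdx q x y * u + qdy q x y * v.
Proof. by move=> qG xyG q0 *; apply: dir_ge0 => //; exact: inG_small. Qed.

Definition critical q x y := [/\ q x y = 0, qdx q x y = 0 & qdy q x y = 0].

Lemma criticalE q x y a b : critical q x y -> q a b =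
  k20 q * (a - x) ^+ 2 + k11 q * ((a - x) * (b - y)) + k02 q * (b - y) ^+ 2.
Proof.
move=> [q0 qx qy]; have -> : q a b = q (x + (a - x)) (y + (b - y)).
  by congr (ev q); ring.
by rewrite quadD q0 qx qy !mul0r !add0r.
Qed.

Lemma cone_line x y u v : inG x y -> ~ corner x y ->
  cone (fun a b => (v * (a - x) - u * (b - y)) ^+ 2).
Proof.
move=> xyG nc; have [uv|] := boolP ((u != 0) || (v != 0)).
  by have [s s0 sG] := line_meets_G xyG nc uv; exact: cone_sq xyG sG s0.
rewrite negb_or !negbK => /andP[/eqP-> /eqP->].
by apply: cone_ext (@cone0 R) => a b; rewrite !mul0r subrr expr0n.
Qed.

(* q is a quadratic form at the critical zero; it is semidefinite since every
   line through a zero that is not a corner meets G in a second point. *)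
Lemma cone_critical q x y : posG q -> inG x y -> ~ corner x y ->
  critical q x y -> cone q.
Proof.
move=> qG xyG nc cr.
have psd u v : 0 <= k20 q * u ^+ 2 + k11 q * (u * v) + k02 q * v ^+ 2.
  have [uv|] := boolP ((u != 0) || (v != 0)); last first.
    by rewrite negb_or !negbK => /andP[/eqP-> /eqP->]; lra.
  have [s s0 /qG] := line_meets_G xyG nc uv; rewrite (criticalE _ _ cr).
  have s2 : 0 < s ^+ 2 by rewrite exprn_even_gt0.
  move=> H; rewrite -(pmulr_rge0 _ s2); apply: eq_ge0 H; ring.
have A0 : 0 <= k20 q by have := psd 1 0; lra.
have C0 : 0 <= k02 q by have := psd 0 1; lra.
move: A0; rewrite le_eqVlt => /orP[/eqP A0|A0].
  have B0 : k11 q = 0.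
    (* With k20 = 0 and k11 nonzero, the form takes the value -1 in this direction. *)
    apply/eqP/negPn/negP => B0; have := psd (- (k02 q + 1) / k11 q) 1.
    rewrite -A0 mul0r add0r mulr1 mulrCA divff // mulr1 expr1n; lra.
  apply: cone_ext (coneZ C0 (cone_line 1 0 xyG nc)) => a b.
  by rewrite (criticalE _ _ cr) -A0 B0; ring.
have D0 : 0 <= k02 q - k11 q ^+ 2 / (4 * k20 q).
  have := psd (- k11 q / (2 * k20 q)) 1; apply: eq_ge0; field.
  by rewrite gt_eqF.
apply: cone_ext (coneD (coneZ (ltW A0) (cone_line (- k11 q / (2 * k20 q)) 1 xyG nc))
  (coneZ D0 (cone_line 1 0 xyG nc))) => a b.
rewrite (criticalE _ _ cr); field.
by rewrite gt_eqF.
Qed.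

(* At the corner A the form is only copositive. *)
Lemma cone_critical_A q : posG q -> critical q 2^-1 2^-1 -> cone q.
Proof.
move=> qG cr.
have copos u v : 0 <= u -> 0 <= v ->
    0 <= k20 q * u ^+ 2 + k11 q * (u * v) + k02 q * v ^+ 2.
  move=> u0 v0.
  have AG : inG (2^-1) (2^-1 : R) by split; lra.
  have [|s s0 /qG] := for_small_ex
    (inG_small (u := u) (v := v) AG (fun _ => u0) (fun _ => v0) _).
    by lra.
  rewrite (criticalE _ _ cr).
  have s2 : 0 < s ^+ 2 by rewrite exprn_gt0.
  move=> H; rewrite -(pmulr_rge0 _ s2); apply: eq_ge0 H; ring.
have A0 : 0 <= k20 q by have := copos 1 0 ler01 (lexx _); lra.
have C0 : 0 <= k02 q by have := copos 0 1 (lexx _) ler01; lra.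
have AG : inG (2^-1) (2^-1 : R) by split; lra.
have sqA : cone (fun a b : R => (1 * (a - 2^-1) - 0 * (b - 2^-1)) ^+ 2).
  by apply: (cone_sq (s := 1)) => //; [split; lra|exact: oner_neq0].
have sqC : cone (fun a b : R => (0 * (a - 2^-1) - 1 * (b - 2^-1)) ^+ 2).
  by apply: (cone_sq (s := 1)) => //; [split; lra|exact: oner_neq0].
have [B0|B0] := leP 0 (k11 q).
  apply: cone_ext (coneD (coneD (coneZ A0 sqA) (coneZ C0 sqC))
    (coneZ B0 (cone_AB_AC R))) => a b.
  by rewrite (criticalE _ _ cr); ring.
move: A0; rewrite le_eqVlt => /orP[/eqP A0|A0].
  have H : 0 <= (k02 q + 1) / - k11 q by rewrite divr_ge0 // ?oppr_ge0 ?ltW //; lra.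
  have := copos _ 1 H ler01.
  have -> : k11 q * ((k02 q + 1) / - k11 q * 1) = - (k02 q + 1).
    by field; rewrite lt_eqF.
  by rewrite -A0; lra.
(* For k11 < 0 the square is completed along a direction with positive coordinates, so its line
   enters G from A. *)
have u0 : 0 < - k11 q / (2 * k20 q) by rewrite divr_gt0 //; lra.
have D0 : 0 <= k02 q - k11 q ^+ 2 / (4 * k20 q).
  have := copos (- k11 q / (2 * k20 q)) 1 (ltW u0) ler01; apply: eq_ge0; field.
  by rewrite gt_eqF.
have [|s s0 sG] := for_small_ex (inG_small (u := - k11 q / (2 * k20 q)) (v := 1) AG
   (fun _ => ltW u0) (fun _ => ler01) _); first by lra.
apply: cone_ext (coneD (coneZ (ltW A0) (cone_sq AG sG _))
  (coneZ D0 sqC)) => [a b|]; last by rewrite gt_eqF.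
rewrite (criticalE _ _ cr); field.
by rewrite gt_eqF.
Qed.

(** No positive multiple of p can be subtracted from q without losing nonnegativity on G. *)
Definition stuck q p := forall e, 0 < e -> exists x y, inG x y /\ q x y < e * p x y.

(** The supremum of the admissible multiples is finite because p > 0 at (x1,y1), and attained
    because each inequality l p <= q is closed in l. *)
Lemma max_sub q p x1 y1 : posG q -> posG p -> inG x1 y1 -> 0 < p x1 y1 ->
  exists l : R, [/\ 0 <= l, posG (qsub q l p) & stuck (qsub q l p) p].
Proof.
move=> qG pG G1 p1; pose E : set R := [set l | posG (qsub q l p)].
have E0 : E 0 by move=> x y /qG; rewrite qsubE mul0r subr0.
have ubE x y : inG x y -> 0 < p x y -> ubound E (q x y / p x y).
  by move=> xyG pxy l /(_ _ _ xyG); rewrite qsubE subr_ge0 ler_pdivlMr.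
have sE : has_sup E by split; [exists 0|exists (q x1 y1 / p x1 y1); exact: ubE].
exists (sup E); split; first exact: (sup_upper_bound sE E0).
  move=> x y xyG; rewrite qsubE subr_ge0.
  have := pG _ _ xyG; rewrite le_eqVlt => /orP[/eqP<-|pxy].
    by rewrite mulr0; exact: qG.
  by rewrite -ler_pdivlMr //; apply: ge_sup (ubE _ _ xyG pxy); exists 0.
move=> e e0; apply: contrapT => H.
have : E (sup E + e).
  move=> x y xyG; rewrite leNgt; apply/negP => L; apply: H; exists x, y; split=> //.
  by move: L; rewrite !qsubE; lra.
by move/(sup_upper_bound sE); lra.
Qed.

Definition cluster q p x0 y0 := forall e d, 0 < e -> 0 < d ->
  exists x y, [/\ inG x y, `|x - x0| < d, `|y - y0| < d & q x y < e * p x y].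

Lemma stuck_cluster q p : posG p -> stuck q p ->
  exists x0 y0, inG x0 y0 /\ cluster q p x0 y0.
Proof.
move=> pG st.
have [||x0 [y0 [/andP[x1 x2] /andP[y1 y2] H]]] :=
  @square_cluster R 2^-1 2 (fun e x y => inG x y /\ q x y < e * p x y).
- move=> e e' x y ee' [xyG L]; split=> //; apply: lt_le_trans L _.
  by apply: ler_wpM2r => //; exact: pG.
- move=> e /st[x [y [xyG L]]]; exists x, y; have [? ?] := inG_le2 xyG.
  by have [? ? ?] := xyG; split=> //; apply/andP.
exists x0, y0; split; last first.
  move=> e d e0 d0; have [x [y [xd yd [xyG L]]]] := H e d e0 d0.
  by exists x, y.
split=> //; rewrite leNgt; apply/negP => L.
(* The quadratic here is x y; its continuity shows that G is closed along Gamma. *)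
have [|d d0 D] := quad_near (Quad 0 0 0 0 1 0) x0 y0 (_ : 0 < x0 * y0 - 1); first by lra.
have [x [y [xd yd [[_ _ xy] _]]]] := H 1 d ltr01 d0.
by have := D x y xd yd; rewrite /ev /= ltr_norml; lra.
Qed.

(** If r were positive at (x0,y0), then q >= c p r would give q >= e p nearby with e = c r(x0,y0) /
    2. A local lower bound for q thus becomes a sign condition at the cluster point. *)
Lemma cluster_le0 q p r c d x0 y0 : posG p -> cluster q p x0 y0 ->
  0 < c -> 0 < d ->
  (forall x y, inG x y -> `|x - x0| < d -> `|y - y0| < d -> 0 < r x y ->
     c * p x y * r x y <= q x y) ->
  r x0 y0 <= 0.
Proof.
move=> pG cl c0 d0 H; rewrite leNgt; apply/negP => r0.
have [|d1 d10 D] := quad_near r x0 y0 (_ : 0 < r x0 y0 / 2); first by lra.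
have e0 : 0 < c * (r x0 y0 / 2) by apply: mulr_gt0 => //; lra.
have [|x [y [xyG xd yd L]]] := cl _ (Num.min d d1) e0; first by rewrite lt_min d0.
move: xd yd; rewrite !lt_min => /andP[xd xd1] /andP[yd yd1].
have := D x y xd1 yd1; rewrite ltr_norml => /andP[rxy _].
have rp : 0 < r x y by lra.
have := H x y xyG xd yd rp; apply/negP; rewrite -ltNge; apply: lt_le_trans L _.
rewrite mulrAC; apply: ler_wpM2l; last by lra.
by apply: mulr_ge0; [exact: ltW|exact: pG].
Qed.

End Stuck.

(** * Cluster points for [l_Gamma] and for [l_AB * l_AC] *)

Section Stuck2.
Variable R : realType.
Local Coercion ev : quad >-> Funclass.
Implicit Types (p q r : quad R) (x y c u v w : R).

Definition qGamma : quad R := Quad 1 0 0 0 (-1) 0.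
Definition qABAC : quad R := Quad (4^-1) (- 2^-1) (- 2^-1) 0 1 0.

Definition qABBC : quad R := Quad (- (5 / 4)) 3 2^-1 (-1) (-1) 0.

Lemma qABBCE x y : qABBC x y = (x - 2^-1) * (5 / 2 - x - y).
Proof. by rewrite /ev /=; field. Qed.

Lemma qGammaE x y : qGamma x y = 1 - x * y.
Proof. by rewrite /ev /=; ring. Qed.

Lemma qABACE x y : qABAC x y = (x - 2^-1) * (y - 2^-1).
Proof. by rewrite /ev /=; field. Qed.

Lemma posG_Gamma : posG qGamma.
Proof. by move=> x y [_ _ xy]; rewrite qGammaE subr_ge0. Qed.

Lemma posG_ABAC : posG qABAC.
Proof. by move=> x y [x1 y1 _]; rewrite qABACE mulr_ge0 // subr_ge0. Qed.

Lemma cluster_swap q p x0 y0 : cluster q p x0 y0 ->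
  cluster (swapq q) (swapq p) y0 x0.
Proof.
move=> cl e d e0 d0; have [x [y [/inG_sym G' xd yd L]]] := cl e d e0 d0.
by exists y, x; split; rewrite ?swapqE.
Qed.

Lemma cluster_zero q p M x0 y0 : posG q -> posG p -> 0 < M ->
  (forall x y, inG x y -> p x y <= M) -> inG x0 y0 -> cluster q p x0 y0 ->
  q x0 y0 = 0.
Proof.
move=> qG pG M0 pM G0 cl; apply/eqP; rewrite eq_le qG // andbT.
have Mi : 0 < M^-1 by rewrite invr_gt0.
(* Here r is q itself: p <= M gives p q / M <= q. *)
apply: (cluster_le0 pG cl Mi ltr01) => x y xyG _ _ qxy.
by rewrite -[leRHS]mul1r ler_pM2r // mulrC ler_pdivrMr // mul1r pM.
Qed.

(* q(x,y) and q(x,1/x) differ by a multiple of l_Gamma. *)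
Lemma Gamma_cluster_dy q x0 y0 : posG q -> cluster q qGamma x0 y0 -> inG x0 y0 ->
  x0 * y0 = 1 -> 0 <= qdy q x0 y0.
Proof.
move=> qG cl [x01 y01 _] xy1.
(* q(x,y) = q(x,1/x) + (1 - x y) r(x,y) / x^2, and on Gamma r(x0,y0) is - x0 times [qdy q x0 y0]. *)
pose r := Quad (- k02 q) (- k01 q) 0 (- k11 q) (- k02 q) 0.
have : r x0 y0 <= 0.
  apply: (cluster_le0 posG_Gamma cl (_ : 0 < 4^-1) ltr01); first by lra.
  move=> x y xyG _ _ rxy; have [x2 _] := inG_le2 xyG; have [x1 y1 xy] := xyG.
  have x0' : 0 < x by lra.
  have -> : q x y = q x x^-1 + (1 - x * y) * r x y / x ^+ 2.
    by rewrite /ev /=; field; rewrite gt_eqF.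
  rewrite qGammaE -mulrA mulrC; apply: ler_wpDl; first exact/qG/inG_Gamma.
  apply: ler_wpM2l; first by apply: mulr_ge0; [lra|exact: ltW].
  by rewrite lef_pV2 ?posrE ?exprn_gt0 //; nra.
rewrite /ev /= => H; have : 0 <= x0 * qdy q x0 y0.
  by rewrite /qdy; have := congr1 ( *%R (k02 q)) xy1; nra.
by rewrite pmulr_rge0 //; lra.
Qed.

(* q(x,y) and q(1/2,y) differ by a multiple of l_AB. *)
Lemma ABAC_cluster_dx q y0 : posG q -> cluster q qABAC 2^-1 y0 ->
  qdx q 2^-1 y0 <= 0.
Proof.
move=> qG cl.
pose r := Quad (k10 q + 2^-1 * k20 q) (k20 q) (k11 q) 0 0 0.
have -> : qdx q 2^-1 y0 = r 2^-1 y0 by rewrite /qdx /ev /=; field.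
apply: (cluster_le0 posG_ABAC cl (_ : 0 < 2^-1) ltr01); first by lra.
move=> x y xyG _ _ rxy; have [_ y2] := inG_le2 xyG; have [x1 y1 xy] := xyG.
have -> : q x y = q 2^-1 y + (x - 2^-1) * r x y by rewrite /ev /=; field.
apply: ler_wpDl; first by apply: qG; split => //; nra.
apply: ler_wpM2r; first exact: ltW.
by rewrite qABACE; nra.
Qed.

(* The conclusion says that q vanishes to second order at B along Gamma. *)
Lemma ABAC_cluster_B q : posG q -> q 2^-1 2 = 0 -> cluster q qABAC 2^-1 2 ->
  qdx q 2^-1 2 - 4 * qdy q 2^-1 2 = 0.
Proof.
move=> qG q0 cl; have hdx := ABAC_cluster_dx qG cl.
have BG : inG (2^-1) (2 : R) by split; lra.
have hdy : 0 <= qdx q 2^-1 2 * 0 + qdy q 2^-1 2 * (-1).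
  by apply: posG_dir => // *; lra.
have T0 : 0 <= qdx q 2^-1 2 * 4^-1 + qdy q 2^-1 2 * (-1).
  by apply: posG_dir => // *; lra.
apply/eqP; rewrite eq_le; apply/andP; split; last by lra.
(* If the y-derivative at B is zero, [hdx] settles the sign. Otherwise it is negative, s is positive
   near B, and q(x,y) >= q(x,1/x) there. *)
have [D0|D0] := leP 0 (qdy q 2^-1 2); first by lra.
pose s := Quad (- k02 q) (- k01 q) 0 (- k11 q) (- k02 q) 0.
have [|d d0 D] := quad_near s 2^-1 2 (_ : 0 < - qdy q 2^-1 2 / 2); first by lra.
pose M := 3 * `|qdx q 2^-1 2| + 2 * `|qdy q 2^-1 2| + 4 * `|k20 q| + 4 * `|k11 q|
  + 4 * `|k02 q|.
pose T := qdx q 2^-1 2 - 4 * qdy q 2^-1 2.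
(* q(x,1/x) = (x - 1/2) (T / 4 + (x - 1/2) N) / x^2 with N >= - M, so r bounds the middle factor
   from below; at B it equals T / 4. *)
pose r := Quad (T / 4 + M / 2) (- M) 0 0 0 0.
suff : r 2^-1 2 <= 0 by rewrite /ev /= -/T; lra.
apply: (cluster_le0 posG_ABAC cl (_ : 0 < 8^-1) d0); first by lra.
move=> x y xyG xd yd rxy; have [x2 y2] := inG_le2 xyG; have [x1 y1 xy] := xyG.
have x0' : 0 < x by lra.
have sxy : 0 <= s x y.
  have := D x y xd yd; rewrite ltr_norml => /andP[+ _].
  by move: D0; rewrite /ev /qdy /=; lra.
apply: (@le_trans _ _ (q x x^-1)); last first.
  have -> : q x y = q x x^-1 + (1 - x * y) * s x y / x ^+ 2.
    by rewrite /ev /=; field; rewrite gt_eqF.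
  rewrite ler_wpDr // mulr_ge0 ?invr_ge0 ?sqr_ge0 // mulr_ge0 //; lra.
pose N := qdx q 2^-1 2 * (x + 2^-1) - 2 * qdy q 2^-1 2 + k20 q * x ^+ 2
  - 2 * k11 q * x + 4 * k02 q.
have -> : q x x^-1 = (x - 2^-1) * (T / 4 + (x - 2^-1) * N) / x ^+ 2.
  have -> : q x x^-1 = q x x^-1 - q 2^-1 2 by rewrite q0 subr0.
  by rewrite /N /T /ev /qdx /qdy; field; rewrite gt_eqF.
have NM : - M <= N.
  have B (a b : R) c : 0 <= b -> b <= c -> - (c * `|a|) <= a * b.
    move=> b0 bc; have := ler_norm (- a); rewrite normrN => aa.
    by have := normr_ge0 a; nra.
  have := B (qdx q 2^-1 2) (x + 2^-1) 3; have := B (k20 q) (x ^+ 2) 4.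
  have := ler_norm (qdy q 2^-1 2); have := ler_norm (- k02 q); rewrite normrN.
  have := B (- k11 q) x 2; rewrite normrN.
  have : x ^+ 2 <= 4 by nra.
  rewrite /M /N => ? /(_ ltac:(lra) ltac:(lra)) ? ? ? /(_ (sqr_ge0 _) ltac:(lra)) ?
    /(_ ltac:(lra) ltac:(lra)) ?; lra.
have rE : r x y = T / 4 - (x - 2^-1) * M by rewrite /ev /=; field.
have rN : r x y <= T / 4 + (x - 2^-1) * N by rewrite rE; nra.
apply: (@le_trans _ _ ((x - 2^-1) * r x y / x ^+ 2)); last first.
  by rewrite ler_wpM2r ?invr_ge0 ?sqr_ge0 // ler_wpM2l // subr_ge0.
have -> : 8^-1 * qABAC x y * r x y = (x - 2^-1) * r x y * ((y - 2^-1) / 8).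
  by rewrite qABACE; ring.
have X2 : 4^-1 <= (x ^+ 2)^-1 by rewrite lef_pV2 ?posrE ?exprn_gt0 //; nra.
by apply: ler_wpM2l; [apply: mulr_ge0; lra|lra].
Qed.

(** At the cluster point q is zero and admissible directions bound its derivatives. On Gamma
    [Gamma_cluster_dy] adds the missing sign. The gradient vanishes off AB and AC; on a side, away
    from A, the derivative along it vanishes. *)
Lemma stuck_Gamma q : posG q -> stuck q qGamma ->
  [\/ exists x y, [/\ inG x y, ~ corner x y & critical q x y],
      exists s, [/\ 2^-1 < s, s <= 2, q 2^-1 s = 0 & qdy q 2^-1 s = 0],
      exists s, [/\ 2^-1 < s, s <= 2, q s 2^-1 = 0 & qdx q s 2^-1 = 0]
    | q 2^-1 2^-1 = 0].
Proof.
move=> qG /(stuck_cluster posG_Gamma)[x [y [xyG cl]]].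
have q0 : q x y = 0.
  apply: (cluster_zero qG posG_Gamma ltr01 _ xyG cl) => a b [? ? ?].
  by rewrite qGammaE; nra.
have [x1 y1 xy] := xyG; have [x2 y2] := inG_le2 xyG.
have [xh|xh] := eqVneq x 2^-1; have [yh|yh] := eqVneq y 2^-1.
- by apply: Or44; rewrite -{1}xh -yh.
- have ylt : 2^-1 < y by rewrite lt_neqAle eq_sym yh.
  apply: Or42; exists y; split=> //; rewrite -xh //.
  have : 0 <= qdx q x y * 0 + qdy q x y * (-1).
    by apply: posG_dir => // [/eqP|]; [rewrite (negbTE yh)|lra].
  move: xy; rewrite le_eqVlt => /orP[/eqP xy|xy].
    by have := Gamma_cluster_dy qG cl xyG xy; rewrite xh; lra.
  have : 0 <= qdx q x y * 0 + qdy q x y * 1.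
    by apply: posG_dir => // ?; lra.
  by rewrite xh; lra.
- have xlt : 2^-1 < x by rewrite lt_neqAle eq_sym xh.
  apply: Or43; exists x; split=> //; rewrite -yh //.
  have : 0 <= qdx q x y * (-1) + qdy q x y * 0.
    by apply: posG_dir => // [/eqP|]; [rewrite (negbTE xh)|lra].
  move: xy; rewrite le_eqVlt => /orP[/eqP xy|xy].
    have yx : y * x = 1 by rewrite mulrC.
    have := Gamma_cluster_dy (posG_swap qG) (cluster_swap cl) (inG_sym xyG) yx.
    by rewrite qdy_swap yh; lra.
  have : 0 <= qdx q x y * 1 + qdy q x y * 0.
    by apply: posG_dir => // ?; lra.
  by rewrite yh; lra.
have xlt : 2^-1 < x by rewrite lt_neqAle eq_sym xh.
have ylt : 2^-1 < y by rewrite lt_neqAle eq_sym yh.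
apply: Or41; exists x, y; split=> //.
  by case=> -[E E']; [move: xh|move: xh|move: yh]; rewrite ?E ?E' eqxx.
have D1 : 0 <= qdx q x y * (-1) + qdy q x y * 0 by apply: posG_dir => //; lra.
have D2 : 0 <= qdx q x y * 0 + qdy q x y * (-1) by apply: posG_dir => //; lra.
move: xy; rewrite le_eqVlt => /orP[/eqP xy|xy].
  have yx : y * x = 1 by rewrite mulrC.
  have := Gamma_cluster_dy (posG_swap qG) (cluster_swap cl) (inG_sym xyG) yx.
  have := Gamma_cluster_dy qG cl xyG xy.
  by rewrite qdy_swap; split=> //; lra.
have D3 : 0 <= qdx q x y * 1 + qdy q x y * 0 by apply: posG_dir => //; lra.
have D4 : 0 <= qdx q x y * 0 + qdy q x y * 1 by apply: posG_dir => //; lra.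
by split=> //; lra.
Qed.

(** Inside G the gradient vanishes; on a side or at A [ABAC_cluster_dx] forces the inward derivative
    to vanish too. On Gamma the tangential derivative vanishes, at B and C by [ABAC_cluster_B]. *)
Lemma stuck_ABAC q : posG q -> stuck q qABAC ->
  [\/ exists x y, [/\ inG x y, ~ corner x y & critical q x y],
      critical q 2^-1 2^-1
    | exists v, [/\ 2^-1 <= v, v <= 2, q v v^-1 = 0 &
        v ^+ 2 * qdx q v v^-1 - qdy q v v^-1 = 0]].
Proof.
move=> qG /(stuck_cluster posG_ABAC)[x [y [xyG cl]]].
have q0 : q x y = 0.
  apply: (cluster_zero qG posG_ABAC (_ : 0 < 4) _ xyG cl) => [|a b abG]; first by lra.
  have [? ?] := inG_le2 abG; have [? ? ?] := abG.
  by rewrite qABACE; nra.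
have cl' : cluster (swapq q) qABAC y x by exact: cluster_swap cl.
have [x1 y1 xy] := xyG; have [x2 y2] := inG_le2 xyG.
move: xy; rewrite le_eqVlt => /orP[/eqP xy|xy].
  have x0 : 0 < x by lra.
  have xn0 : x != 0 by rewrite gt_eqF.
  have yE : y = x^-1 by apply: (mulfI xn0); rewrite xy divff.
  apply: Or33; exists x; split; rewrite -?yE //.
  have [xh|xh] := eqVneq x 2^-1.
    have y2E : y = 2 by move: xy; rewrite xh; lra.
    rewrite xh y2E in q0 cl *.
    by have := ABAC_cluster_B qG q0 cl; lra.
  have [yh|yh] := eqVneq y 2^-1.
    have x2E : x = 2 by move: xy; rewrite yh; lra.
    rewrite yh x2E in q0 cl' *; rewrite -swapqE in q0.
    have := ABAC_cluster_B (posG_swap qG) q0 cl'.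
    by rewrite qdx_swap qdy_swap; lra.
  have E : x ^+ 2 * y = x by rewrite expr2 -mulrA xy mulr1.
  have xlt : 2^-1 < x by rewrite lt_neqAle eq_sym xh.
  have ylt : 2^-1 < y by rewrite lt_neqAle eq_sym yh.
  have : 0 <= qdx q x y * x ^+ 2 + qdy q x y * (-1).
    apply: posG_dir => //; [by lra|by lra|move=> _; right].
    by rewrite E mulrN1 oppr_le0 sqr_ge0; split=> //; lra.
  have : 0 <= qdx q x y * (- x ^+ 2) + qdy q x y * 1.
    apply: posG_dir => //; [by lra|move=> _; right].
    by rewrite mulNr E mulr1 oppr_le0 sqr_ge0; split=> //; lra.
  by lra.
have [xh|xh] := eqVneq x 2^-1; have [yh|yh] := eqVneq y 2^-1.
- apply: Or32; rewrite xh yh in q0 cl cl' *.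
  have := ABAC_cluster_dx (posG_swap qG) cl'; rewrite qdx_swap => H1.
  have H2 := ABAC_cluster_dx qG cl.
  have AG : inG (2^-1) (2^-1 : R) by split; lra.
  have D3 : 0 <= qdx q 2^-1 2^-1 * 1 + qdy q 2^-1 2^-1 * 0.
    by apply: posG_dir => // ?; lra.
  have D4 : 0 <= qdx q 2^-1 2^-1 * 0 + qdy q 2^-1 2^-1 * 1.
    by apply: posG_dir => // ?; lra.
  by split=> //; lra.
- have ylt : 2^-1 < y by rewrite lt_neqAle eq_sym yh.
  apply: Or31; exists x, y; split=> //.
    case=> -[E E']; last by move: yh; rewrite E' eqxx.
      by move: yh; rewrite E' eqxx.
    by move: xy; rewrite xh E'; lra.
  have D2 : 0 <= qdx q x y * 0 + qdy q x y * (-1) by apply: posG_dir => //; lra.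
  have D3 : 0 <= qdx q x y * 1 + qdy q x y * 0 by apply: posG_dir => //; lra.
  have D4 : 0 <= qdx q x y * 0 + qdy q x y * 1 by apply: posG_dir => //; lra.
  rewrite xh in cl; have := ABAC_cluster_dx qG cl; rewrite -xh => H.
  by split=> //; lra.
- have xlt : 2^-1 < x by rewrite lt_neqAle eq_sym xh.
  apply: Or31; exists x, y; split=> //.
    by case=> -[E E']; [move: xh; rewrite E eqxx|move: xh; rewrite E eqxx|
      move: xy; rewrite E yh; lra].
  have D2 : 0 <= qdx q x y * (-1) + qdy q x y * 0 by apply: posG_dir => //; lra.
  have D3 : 0 <= qdx q x y * 1 + qdy q x y * 0 by apply: posG_dir => //; lra.
  have D4 : 0 <= qdx q x y * 0 + qdy q x y * 1 by apply: posG_dir => //; lra.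
  rewrite yh in cl'; have := ABAC_cluster_dx (posG_swap qG) cl'.
  rewrite qdx_swap -yh => H.
  by split=> //; lra.
have xlt : 2^-1 < x by rewrite lt_neqAle eq_sym xh.
have ylt : 2^-1 < y by rewrite lt_neqAle eq_sym yh.
apply: Or31; exists x, y; split=> //.
  by case=> -[E E']; [move: xh|move: xh|move: yh]; rewrite ?E ?E' eqxx.
have D1 : 0 <= qdx q x y * (-1) + qdy q x y * 0 by apply: posG_dir => //; lra.
have D2 : 0 <= qdx q x y * 0 + qdy q x y * (-1) by apply: posG_dir => //; lra.
have D3 : 0 <= qdx q x y * 1 + qdy q x y * 0 by apply: posG_dir => //; lra.
have D4 : 0 <= qdx q x y * 0 + qdy q x y * 1 by apply: posG_dir => //; lra.
by split=> //; lra.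
Qed.

End Stuck2.

(** * Double zeros on AC *)

Section CaseAC.
Variable R : realType.
Local Coercion ev : quad >-> Funclass.
Implicit Types (p q r : quad R) (x y c u v w : R).

Lemma cone_sqAC : cone (fun x y : R => (y - 2^-1) ^+ 2).
Proof.
apply: cone_ext (cone_sq (x := 2^-1) (y := 2^-1) (s := 1) (u := 1) (v := 0) _ _ _).
- by move=> x y; ring.
- by split; lra.
- by split; lra.
- exact: oner_neq0.
Qed.

(** q vanishes along AC, so it is [l_AC] times an affine function; the coefficients come from the
    y-derivatives at A and C and the value at B. *)
Lemma cone_zero_AC q : posG q -> k20 q = 0 -> q 2^-1 2^-1 = 0 -> q 2 2^-1 = 0 ->
  cone q.
Proof.
move=> qG q20 qA qC.
have AG : inG (2^-1) (2^-1 : R) by split; lra.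
have BG : inG (2^-1) (2 : R) by split; lra.
have CG : inG 2 (2^-1 : R) by split; lra.
have mA : 0 <= qdx q 2^-1 2^-1 * 0 + qdy q 2^-1 2^-1 * 1.
  by apply: posG_dir => // ?; lra.
have mC : 0 <= qdx q 2 2^-1 * (- 5) + qdy q 2 2^-1 * 1.
  by apply: posG_dir => // ?; lra.
have mB := qG _ _ BG.
have mA' : 0 <= 2 / 3 * qdy q 2^-1 2^-1 by lra.
have mC' : 0 <= 2 / 3 * qdy q 2 2^-1.
  by move: qA qC mC; rewrite /ev /qdx /qdy q20; lra.
have mB' : 0 <= 4 / 9 * q 2^-1 2 by lra.
apply: cone_ext (coneD (coneZ mA' (cone_AC_BC R))
  (coneD (coneZ mB' cone_sqAC) (coneZ mC' (cone_AB_AC R)))) => x y.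
have E0 : k00 q = - k01 q / 2 - k02 q / 4.
  by move: qA qC; rewrite /ev q20; lra.
have E1 : k10 q = - k11 q / 2 by move: qA qC; rewrite /ev q20; lra.
by rewrite /ev /qdy q20 E0 E1; field.
Qed.

(* The remainder after subtracting the right multiple of l_AB l_AC is a form
   at C, nonnegative on the cone |X| >= Y that AB subtends there. *)
Lemma cone_zero_C q : posG q ->
  critical (qsub q (2 / 3 * qdy q 2 2^-1) (qABAC R)) 2 2^-1 -> cone q.
Proof.
move=> qG cr; set m := 2 / 3 * _ in cr *; set r := qsub _ _ _ in cr.
have CG : inG 2 (2^-1 : R) by split; lra.
have qr x y : q x y = r x y + m * ((x - 2^-1) * (y - 2^-1)).
  by rewrite qsubE qABACE subrK.
have m0 : 0 <= m.
  have qC : q 2 2^-1 = 0 by rewrite qr; case: cr => ->; rewrite subrr !mulr0 addr0.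
  have qx : qdx q 2 2^-1 = 0.
    by case: cr => _ + _; rewrite /r /qdx /=; lra.
  have : 0 <= qdx q 2 2^-1 * (- 5) + qdy q 2 2^-1 * 1.
    by apply: posG_dir => // ?; lra.
  by rewrite /m qx; lra.
suff cr' : cone r by apply: cone_ext (coneD cr' (coneZ m0 (cone_AB_AC R))).
(* Y parametrizes AB by (1/2, 1/2 + 3 Y / 2), which seen from C is the direction (-1,Y). *)
have H Y : 0 <= Y -> Y <= 1 -> 0 <= k20 r - k11 r * Y + k02 r * Y ^+ 2.
  move=> Y0 Y1; have : inG (2^-1) (2^-1 + 3 / 2 * Y) by split; lra.
  move/qG; rewrite qr (criticalE _ _ cr) subrr mul0r mulr0 addr0 => Q.
  have P : 0 < (9 / 4 : R) by lra.
  by rewrite -(pmulr_rge0 _ P); apply: eq_ge0 Q; field.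
have d0 : 0 <= k20 r by have := H 0; lra.
have f0 : 0 <= k20 r - k11 r + k02 r by have := H 1; lra.
have sqBC : cone (fun x y : R => (5 / 2 - x - y) ^+ 2).
  apply: cone_ext (cone_sq (u := 1) (v := -1) (s := - (3 / 2)) CG _ _).
  - by move=> x y; field.
  - by split; lra.
  - by rewrite oppr_eq0; apply/eqP; lra.
(* In terms of [l_BC] and [l_AC] the mixed coefficient is 2 k20 - k11. If it is negative, then k20 >
   0 and the square is completed with the line from C to the point Y = 2 k20 / k11 of AB. *)
have [e0|e0] := leP (k11 r) (2 * k20 r).
  have e0' : 0 <= 2 * k20 r - k11 r by lra.
  apply: cone_ext (coneD (coneZ d0 sqBC) (coneD (coneZ e0' (cone_AC_BC R))
    (coneZ f0 cone_sqAC))) => x y.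
  by rewrite (criticalE _ _ cr); field.
have [d1|d1] := eqVneq (k20 r) 0.
  have : 0 <= - k11 r.
    apply: (@for_small_ge0 _ _ (k02 r)); exists 1 => // s /andP[s0 s1].
    rewrite -(pmulr_rge0 _ s0); apply: eq_ge0 (H s (ltW s0) s1).
    by rewrite d1; ring.
  by lra.
have d2 : 0 < k20 r by rewrite lt_neqAle eq_sym d1.
have e1 : 0 < k11 r by lra.
have Y0 : 0 < 2 * k20 r / k11 r by rewrite divr_gt0 //; lra.
have Y1 : 2 * k20 r / k11 r <= 1 by rewrite ler_pdivrMr //; lra.
have D0 : 0 <= k02 r - k11 r ^+ 2 / (4 * k20 r).
  have P : 0 < (2 * k20 r / k11 r) ^+ 2 by rewrite exprn_gt0.
  rewrite -(pmulr_rge0 _ P); apply: eq_ge0 (H _ (ltW Y0) Y1); field.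
  by rewrite !gt_eqF.
have sq : cone (fun x y => (2 * k20 r / k11 r * (x - 2) - (-1) * (y - 2^-1)) ^+ 2).
  apply: (cone_sq (s := 3 / 2) CG); last by apply/eqP; lra.
  by split; lra.
have c0 : 0 <= k11 r ^+ 2 / (4 * k20 r).
  by rewrite divr_ge0 ?sqr_ge0 //; lra.
apply: cone_ext (coneD (coneZ c0 sq) (coneZ D0 cone_sqAC)) => x y.
by rewrite (criticalE _ _ cr); field; rewrite !gt_eqF.
Qed.

(* x - w = slope v w * (y - 1/2) is the line through (w,1/2) and (v,1/v). *)
Definition slope v w : R := 2 * v * (v - w) / (2 - v).

(* x + v^2 y = 2 v is the tangent to Gamma at (v,1/v). *)
Lemma touch_AC q v w : 2^-1 <= v -> v < 2 ->
  q w 2^-1 = 0 -> qdx q w 2^-1 = 0 ->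
  q v v^-1 = 0 -> v ^+ 2 * qdx q v v^-1 - qdy q v v^-1 = 0 ->
  exists n, [/\ qdy q w 2^-1 = n * (w + v ^+ 2 / 2 - 2 * v) &
    forall x y, q x y = k20 q * (x - w - slope v w * (y - 2^-1)) ^+ 2
      + n * ((y - 2^-1) * (x + v ^+ 2 * y - 2 * v))].
Proof.
move=> v1 v2 q0 qx qv tv; have v0 : v != 0 by rewrite gt_eqF //; lra.
have v2n : 2 - v != 0 by rewrite gt_eqF // subr_gt0.
have T a b : q a b = qdy q w 2^-1 * (b - 2^-1) + (k20 q * (a - w) ^+ 2
    + k11 q * ((a - w) * (b - 2^-1)) + k02 q * (b - 2^-1) ^+ 2).
  have -> : q a b = q (w + (a - w)) (2^-1 + (b - 2^-1)) by congr (ev q); ring.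
  by rewrite quadD q0 qx; ring.
have Tx a b : qdx q a b = 2 * k20 q * (a - w) + k11 q * (b - 2^-1).
  by move: qx; rewrite /qdx; lra.
have Ty a b : qdy q a b = qdy q w 2^-1 + k11 q * (a - w) + 2 * k02 q * (b - 2^-1).
  by rewrite /qdy; ring.
move: qv tv; rewrite T (Tx v) (Ty v).
set k := slope v w; set U := v^-1 - 2^-1; set m := qdy q w 2^-1.
have UE : U = (2 - v) / (2 * v) by rewrite /U; field.
have U0 : U != 0 by rewrite gt_eqF // UE divr_gt0 //; lra.
have VE : v - w = k * U.
  by rewrite UE /k /slope; field; rewrite ?v0 ?v2n.
rewrite VE => qv tv.
(* The zero at (v,1/v) determines m, and the tangential derivative then determines [k02 q]; [k20 q]
   and [k11 q] stay free. *)
have mE : m = - U * (k20 q * k ^+ 2 + k11 q * k + k02 q).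
  by apply: (mulfI U0); move: qv; lra.
have fE : k02 q = k20 q * k ^+ 2 + v ^+ 2 * (k11 q + 2 * k20 q * k).
  by apply: (mulfI U0); move: tv; rewrite mE; lra.
have wE : w = v - k * U by rewrite -VE; ring.
exists (k11 q + 2 * k20 q * k); split.
  by rewrite mE wE fE UE; field.
move=> x y; rewrite T -/m mE fE wE UE; field.
by [].
Qed.

(** For v > 1/2 this is the ratio of l^2 to l_AC t at B, with l the line through (w,1/2) and (v,1/v)
    and t the tangent at (v,1/v). *)
Definition gcoef v w : R := (2 + 3 * v - 4 * w) ^+ 2 / (3 * (2 - v) ^+ 2).

Lemma gfunE v w x y : v < 2 -> gfun v w x y =
  (x - w - slope v w * (y - 2^-1)) ^+ 2
  - gcoef v w * ((y - 2^-1) * (x + v ^+ 2 * y - 2 * v)).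
Proof.
move=> v2; rewrite /gfun /ffun /beta_ /alpha_ /slope /gcoef; field.
by apply/eqP; lra.
Qed.

End CaseAC.

(** * Double zeros on AC together with a contact with Gamma *)

Section CaseAC2.
Variable R : realType.
Local Coercion ev : quad >-> Funclass.
Implicit Types (p q r : quad R) (x y c u v w : R).

Lemma cone_slope v w : 2^-1 <= v -> v < 2 -> 2^-1 <= w -> w < 2 ->
  cone (fun x y => (x - w - slope v w * (y - 2^-1)) ^+ 2).
Proof.
move=> v1 v2 w1 w2; have v0 : 0 < v by lra.
have WG : inG w (2^-1 : R) by split; lra.
have VG : inG v (v^-1) by apply: inG_Gamma => //; lra.
have U0 : 0 < v^-1 - 2^-1.
  by rewrite subr_gt0 ltf_pV2 ?posrE //; lra.
have E : w + (v^-1 - 2^-1) * slope v w = v.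
  by rewrite /slope; field; rewrite !gt_eqF // subr_gt0.
have E' : 2^-1 + (v^-1 - 2^-1) * 1 = v^-1 by lra.
have := @cone_sq R w 2^-1 (v^-1 - 2^-1) (slope v w) 1 WG.
rewrite E E' gt_eqF // => /(_ VG isT); apply: cone_ext => x y.
by rewrite mul1r.
Qed.

(* The coefficient dN + n is the second order coefficient of q along Gamma at B. *)
Lemma touch_AC_B q v w n : posG q -> 2^-1 <= v -> v < 2 ->
  (forall x y, q x y = k20 q * (x - w - slope v w * (y - 2^-1)) ^+ 2
      + n * ((y - 2^-1) * (x + v ^+ 2 * y - 2 * v))) ->
  0 <= k20 q * gcoef v w + n.
Proof.
move=> qG v1 v2 qE; have v2n : 2 - v != 0 by rewrite gt_eqF // subr_gt0.
(* For v = 1/2 the contact point is B itself; the value at B is replaced by the coefficient of s^2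
   along Gamma at x = 1/2 + s. *)
move: v1; rewrite le_eqVlt => /orP[/eqP v1|v1].
  pose c := 7 / 6 - 4 / 3 * w.
  apply: (@eq_ge0 _ (4 / 3 * (k20 q * c ^+ 2 + 3 / 4 * n))).
    by rewrite /c /gcoef -v1; field.
  apply: mulr_ge0; first by lra.
  apply: (@for_small_quad_ge0 _ _ (2 * k20 q * c - n / 2) (k20 q)).
  exists 1 => // s /andP[s0 s1]; have t0 : 0 < 2^-1 + s by lra.
  have /qG Q : inG (2^-1 + s) (2^-1 + s)^-1 by apply: inG_Gamma; lra.
  have P : 0 < s ^+ 2 / (2^-1 + s) ^+ 2 by rewrite divr_gt0 ?exprn_gt0.
  rewrite -(pmulr_rge0 _ P); apply: eq_ge0 Q; rewrite qE /c /slope -v1.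
  by field; apply/eqP; lra.
have /qG : inG (2^-1) (2 : R) by split; lra.
have P : 0 < 3 * (v - 2^-1) ^+ 2 by rewrite mulr_gt0 // exprn_gt0 // subr_gt0.
move=> Q; rewrite -(pmulr_rge0 _ P); apply: eq_ge0 Q.
by rewrite qE /gcoef /slope; field.
Qed.

(** If the y-derivative at (w,1/2) vanishes, the zero is critical. Otherwise n t > 0 there; for w <
    (2 + 3 v) / 4 this makes n negative and q a combination of g1_{v,w} and l^2, and for larger w it
    contradicts nonnegativity. *)
Lemma cone_touch_AC q v w : posG q -> 2^-1 <= v -> v < 2 -> 2^-1 < w -> w < 2 ->
  q w 2^-1 = 0 -> qdx q w 2^-1 = 0 ->
  q v v^-1 = 0 -> v ^+ 2 * qdx q v v^-1 - qdy q v v^-1 = 0 -> cone q.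
Proof.
move=> qG v1 v2 w1 w2 q0 qx qv tv.
have WG : inG w (2^-1 : R) by split; lra.
have v2n : 2 - v != 0 by rewrite gt_eqF // subr_gt0.
have [n [mE qE]] := touch_AC v1 v2 q0 qx qv tv.
have m0 : 0 <= qdx q w 2^-1 * 0 + qdy q w 2^-1 * 1.
  by apply: posG_dir => // ?; lra.
have [m1|m1] := eqVneq (qdy q w 2^-1) 0.
  apply: (cone_critical qG WG) => //.
  by case=> -[? ?]; lra.
have m2 : 0 < n * (w + v ^+ 2 / 2 - 2 * v).
  by rewrite -mE lt_neqAle eq_sym m1; lra.
have [wv|wv] := ltP w ((2 + 3 * v) / 4).
  have t0 : w + v ^+ 2 / 2 - 2 * v < 0.
    have : 0 <= (2 * v - 1) * (2 - v) by apply: mulr_ge0; lra.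
    by lra.
  have n0 : n < 0 by move: m2; rewrite nmulr_lgt0.
  have N0 : 0 < gcoef v w.
    by apply: divr_gt0; [|apply: mulr_gt0]; rewrite ?exprn_gt0 //; lra.
  have x0 : 0 <= - n / gcoef v w by rewrite divr_ge0 // ?oppr_ge0 ?ltW.
  have y0 : 0 <= k20 q + n / gcoef v w.
    rewrite -(pmulr_lge0 _ N0) mulrDl divfK ?gt_eqF //.
    exact: touch_AC_B qG v1 v2 qE.
  apply: cone_ext (coneD (coneZ x0 (cone_g v1 v2 (ltW w1) wv))
    (coneZ y0 (cone_slope v1 v2 (ltW w1) w2))) => x y.
  rewrite qE gfunE //; field.
  by rewrite gt_eqF.
(* Otherwise q is negative where the line through (w,1/2) and (v,1/v) meets AB. *)
exfalso; have vw : v < w by lra.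
have vwn : w - v != 0 by rewrite gt_eqF // subr_gt0.
(* For v = 1/2 that point is B, where q is zero with a positive y-derivative, so it would be
   negative just below. *)
move: v1; rewrite le_eqVlt => /orP[/eqP v1|v1].
  have BG : inG (2^-1) (2 : R) by split; lra.
  have n0 : 0 < n.
    rewrite -(pmulr_lgt0 n (_ : 0 < w + v ^+ 2 / 2 - 2 * v)) //.
    rewrite lt_neqAle; apply/andP; split; last by rewrite -v1; lra.
    by apply: contraTneq m2 => <-; rewrite mulr0 ltxx.
  have qB : q 2^-1 2 = 0 by rewrite qE /slope -v1; field.
  have : 0 <= qdx q 2^-1 2 * 0 + qdy q 2^-1 2 * (-1).
    by apply: posG_dir => // *; lra.
  have -> : qdy q 2^-1 2 = 3 / 8 * n; last by lra.
  have E : qdy q 2^-1 2 = (q 2^-1 3 - q 2^-1 1) / 2 by rewrite /ev /qdy; field.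
  by rewrite E !qE /slope -v1; field.
(* The line meets AB at height Y above AC, where l^2 vanishes; (2 v - 1)(4 w - 3 v - 2) >= 0 gives Y
   <= 3/2. *)
pose Y := (w - 2^-1) * (2 - v) / (2 * v * (w - v)).
have D0 : 0 < 2 * v * (w - v) by rewrite mulr_gt0 //; lra.
have Y0 : 0 < Y by rewrite /Y divr_gt0 // mulr_gt0 //; lra.
have /qG : inG (2^-1) (2^-1 + Y).
  split; [by lra|by lra|]; suff : Y <= 3 / 2 by lra.
  rewrite /Y ler_pdivrMr //.
  have : 0 <= (2 * v - 1) * (4 * w - 3 * v - 2) by apply: mulr_ge0; lra.
  by lra.
have -> : q 2^-1 (2^-1 + Y) =
    - (Y * ((v - 2^-1) / (w - v)) * (n * (w + v ^+ 2 / 2 - 2 * v))).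
  rewrite qE /slope /Y; field; rewrite v2n vwn andbT gt_eqF //; lra.
rewrite oppr_ge0 leNgt => /negP; apply.
by rewrite mulr_gt0 // mulr_gt0 // divr_gt0 //; lra.
Qed.

Lemma cone_double_AC q w : posG q -> 2^-1 < w -> w <= 2 ->
  q w 2^-1 = 0 -> qdx q w 2^-1 = 0 -> cone q.
Proof.
move=> qG w1; rewrite le_eqVlt => /orP[/eqP-> q0 qx|w2 q0 qx].
  apply: cone_zero_C => //; split; rewrite ?qsubE ?q0 ?qABACE; first by ring.
    by move: qx; rewrite /qdx /=; lra.
  by rewrite /qdy /=; field.
have [||l [l0 rG rS]] := @max_sub R q (qABAC R) 1 1 qG (@posG_ABAC R).
- by split; lra.
- by rewrite qABACE mulr_gt0 //; lra.
set r := qsub _ _ _ in rG rS.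
suff cr : cone r.
  apply: cone_ext (coneD cr (coneZ l0 (cone_AB_AC R))) => x y.
  by rewrite qsubE qABACE subrK.
have r0 : r w 2^-1 = 0 by rewrite qsubE q0 qABACE; ring.
have rx : qdx r w 2^-1 = 0 by move: qx; rewrite /r /qdx /=; lra.
have rE x : r x 2^-1 = k20 r * (x - w) ^+ 2.
  have -> : r x 2^-1 = r (w + (x - w)) (2^-1 + 0) by rewrite addr0 addrC subrK.
  by rewrite quadD r0 rx; ring.
have [[x [y [xyG nc cr]]]|cA|[v [v1]]] := stuck_ABAC rG rS.
- exact: cone_critical rG xyG nc cr.
- exact: cone_critical_A.
rewrite le_eqVlt => /orP[/eqP->|v2] rv tv; last exact: (cone_touch_AC rG v1 v2 w1 w2).
(* For v = 2 the contact point is C; a double zero at (w,1/2) and another zero at C make r vanish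
   along AC. *)
have d0 : k20 r = 0.
  move/eqP: rv; rewrite rE mulf_eq0 sqrf_eq0 => /orP[/eqP//|].
  by rewrite gt_eqF // subr_gt0.
by apply: cone_zero_AC => //; rewrite rE d0 mul0r.
Qed.

End CaseAC2.

(** * Zeros at A *)

Section CaseA.
Variable R : realType.
Local Coercion ev : quad >-> Funclass.
Implicit Types (p q r : quad R) (x y c u v w : R).

Definition qf u : quad R :=
  Quad (- 1 - u ^+ 2 - u) (5 / 2 + 2 * u) (5 / 2 * u ^+ 2 + 2 * u)
       (-1) (- 4 * u) (- u ^+ 2).

Lemma qfE u x y : qf u x y = ffun u x y.
Proof. by rewrite /ev /ffun /=; field. Qed.

Definition qg v w : quad R :=
  let k := slope v w in let N := gcoef v w in let c := k / 2 - w in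
  Quad (c ^+ 2 - N * v) (2 * c + N / 2) (- 2 * k * c + N * (2 * v + v ^+ 2 / 2))
       1 (- 2 * k - N) (k ^+ 2 - N * v ^+ 2).

Lemma qgE v w x y : v < 2 -> qg v w x y = gfun v w x y.
Proof. by move=> v2; rewrite gfunE // /ev /qg /=; field. Qed.

(** By [touch_AC] with w = 1/2, n times the value of the tangent at A is the y-derivative 0, and
    that value is negative. *)
Lemma critical_form_AC q v : 2^-1 <= v -> v < 2 ->
  q 2^-1 2^-1 = 0 -> qdx q 2^-1 2^-1 = 0 -> qdy q 2^-1 2^-1 = 0 ->
  q v v^-1 = 0 -> v ^+ 2 * qdx q v v^-1 - qdy q v v^-1 = 0 ->
  forall x y, q x y = k20 q * (x - 2^-1 - slope v 2^-1 * (y - 2^-1)) ^+ 2.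
Proof.
move=> v1 v2 q0 qx qy qv tv x y.
have [n [nE ->]] := touch_AC v1 v2 q0 qx qv tv.
suff -> : n = 0 by rewrite mul0r addr0.
move/eqP: nE; rewrite qy eq_sym mulf_eq0 => /orP[/eqP//|/eqP E].
have : 0 <= (v - 2^-1) * (2 - v) by apply: mulr_ge0; lra.
by lra.
Qed.

Lemma touch_qsub q l p v : q v v^-1 = 0 -> v ^+ 2 * qdx q v v^-1 - qdy q v v^-1 = 0 ->
  p v v^-1 = 0 -> v ^+ 2 * qdx p v v^-1 - qdy p v v^-1 = 0 ->
  qsub q l p v v^-1 = 0 /\
  v ^+ 2 * qdx (qsub q l p) v v^-1 - qdy (qsub q l p) v v^-1 = 0.
Proof.
move=> qv tq pv tp; split; first by rewrite qsubE qv pv mulr0 subr0.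
have -> : qdx (qsub q l p) v v^-1 = qdx q v v^-1 - l * qdx p v v^-1.
  by rewrite /qdx /=; ring.
have -> : qdy (qsub q l p) v v^-1 = qdy q v v^-1 - l * qdy p v v^-1.
  by rewrite /qdy /=; ring.
have -> : forall a b c d : R, v ^+ 2 * (a - l * b) - (c - l * d) =
  (v ^+ 2 * a - c) - l * (v ^+ 2 * b - d) by move=> *; ring.
by rewrite tq tp mulr0 subr0.
Qed.

Lemma touch_qf u : u != 0 -> qf u u u^-1 = 0 /\
  u ^+ 2 * qdx (qf u) u u^-1 - qdy (qf u) u u^-1 = 0.
Proof. by move=> u0; rewrite /ev /qdx /qdy /=; split; field. Qed.

Lemma touch_qg v w : v != 0 -> v < 2 -> qg v w v v^-1 = 0 /\
  v ^+ 2 * qdx (qg v w) v v^-1 - qdy (qg v w) v v^-1 = 0.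
Proof.
move=> v0 v2; have v2n : 2 - v != 0 by rewrite gt_eqF // subr_gt0.
by rewrite /ev /qdx /qdy /qg /slope /gcoef /=; split; field; rewrite v0.
Qed.

(** f_v and g1_{v,1/2} vanish at B, so q(B) has the sign of z0. For v = 1/2 the second order
    coefficient along Gamma at B is used, to which neither contributes. *)
Lemma touch_A_B q v : posG q -> 2^-1 <= v -> v < 2 -> forall x0 y0 z0,
  (forall x y, q x y = x0 * ffun v x y + y0 * gfun v 2^-1 x y
     + z0 * (x - 2^-1 - slope v 2^-1 * (y - 2^-1)) ^+ 2) ->
  0 <= z0.
Proof.
move=> qG v1 v2 x0 y0 z0 qE; have v2n : 2 - v != 0 by rewrite gt_eqF // subr_gt0.
move: v1; rewrite le_eqVlt => /orP[/eqP v1|v1].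
  suff : 0 <= z0 / 4 by lra.
  apply: (@for_small_quad_ge0 _ _ (z0 + 3 / 2 * x0 + 7 / 6 * y0) (z0 - x0 + y0)).
  exists 1 => // s /andP[s0 s1]; have t0 : 0 < 2^-1 + s by lra.
  have /qG Q : inG (2^-1 + s) (2^-1 + s)^-1 by apply: inG_Gamma; lra.
  have P : 0 < s ^+ 2 / (2^-1 + s) ^+ 2 by rewrite divr_gt0 ?exprn_gt0.
  rewrite -(pmulr_rge0 _ P); apply: eq_ge0 Q.
  rewrite qE gfunE // /gcoef /slope /ffun -v1.
  by field; apply/eqP; lra.
have /qG : inG (2^-1) (2 : R) by split; lra.
have P : 0 < (3 * v * (v - 2^-1) / (2 - v)) ^+ 2.
  by rewrite exprn_gt0 // divr_gt0 ?subr_gt0 // mulr_gt0 ?subr_gt0 //; lra.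
move=> Q; rewrite -(pmulr_rge0 _ P); apply: eq_ge0 Q.
by rewrite qE gfunE // /gcoef /slope /ffun; field.
Qed.

(* The multiples x0 and y0 are chosen so that the remainder has zero gradient at
   A, which makes it a multiple of the squared line through A and (v,1/v). *)
Lemma cone_touch_A1 q v : posG q -> 2^-1 <= v -> v < 2 ->
  q 2^-1 2^-1 = 0 ->
  q v v^-1 = 0 -> v ^+ 2 * qdx q v v^-1 - qdy q v v^-1 = 0 ->
  v ^+ 2 * qdx q 2^-1 2^-1 <= qdy q 2^-1 2^-1 -> cone q.
Proof.
move=> qG v1 v2 q0 qv tv ab.
have v0 : v != 0 by rewrite gt_eqF //; lra.
have v2n : 2 - v != 0 by rewrite gt_eqF // subr_gt0.
have AG : inG (2^-1) (2^-1 : R) by split; lra.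
have a0 : 0 <= qdx q 2^-1 2^-1 * 1 + qdy q 2^-1 2^-1 * 0.
  by apply: posG_dir => // ?; lra.
(* b is the y-derivative of g1_{v,1/2} at A, where its x-derivative is 0; f_v has gradient (3/2, 3/2
   v^2) there. *)
pose b := gcoef v 2^-1 * (4 * v - 1 - v ^+ 2) / 2.
have b0 : 0 < b.
  rewrite /b /gcoef divr_gt0 // mulr_gt0 // ?divr_gt0 //
    ?mulr_gt0 ?exprn_gt0 ?subr_gt0 //; try by lra.
  have : 0 <= (v - 2^-1) * (2 - v) by apply: mulr_ge0; lra.
  by lra.
pose x0 := 2 / 3 * qdx q 2^-1 2^-1.
pose y0 := (qdy q 2^-1 2^-1 - v ^+ 2 * qdx q 2^-1 2^-1) / b.
have x00 : 0 <= x0 by rewrite /x0; lra.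
have y00 : 0 <= y0 by rewrite divr_ge0 ?subr_ge0 // ltW.
pose r := qsub (qsub q x0 (qf v)) y0 (qg v 2^-1).
have [f0 tf] := touch_qf v0; have [g0 tg] := touch_qg 2^-1 v0 v2.
have [r1 t1] := touch_qsub x0 qv tv f0 tf.
have [rv tr] := touch_qsub y0 r1 t1 g0 tg.
have rE := @critical_form_AC r v v1 v2 _ _ _ rv tr.
have qE x y : q x y = x0 * ffun v x y + y0 * gfun v 2^-1 x y
     + k20 r * (x - 2^-1 - slope v 2^-1 * (y - 2^-1)) ^+ 2.
  rewrite -rE; first by rewrite /r !qsubE qfE qgE //; ring.
  - by rewrite /r !qsubE q0 qfE qgE // gfunE // /ffun; ring.
  - have -> : qdx r 2^-1 2^-1 = qdx q 2^-1 2^-1 - x0 * (3 / 2) - y0 * 0.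
      by rewrite /r /qdx /= /gcoef /slope; field.
    by rewrite /x0; field.
  have -> : qdy r 2^-1 2^-1 = qdy q 2^-1 2^-1 - x0 * (3 / 2 * v ^+ 2) - y0 * b.
    by rewrite /r /qdy /b /=; field.
  by rewrite /y0 divfK ?gt_eqF // /x0; field.
have z00 := touch_A_B qG v1 v2 qE.
apply: cone_ext qE _; apply: coneD (coneD (coneZ x00 _) (coneZ y00 _)) (coneZ z00 _).
- by apply: cone_f => //; exact: ltW.
- by apply: cone_g => //; lra.
by apply: cone_slope => //; lra.
Qed.

(** The multiples of f_{1/2} and [l_AB * l_BC] cancel the gradient at A, which leaves a multiple of
    the square of [l_AB], fixed by the value at C. *)
Lemma cone_touch_A2 q : posG q -> q 2^-1 2^-1 = 0 ->
  q 2^-1 2 = 0 -> qdx q 2^-1 2 - 4 * qdy q 2^-1 2 = 0 ->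
  4 * qdy q 2^-1 2^-1 <= qdx q 2^-1 2^-1 -> cone q.
Proof.
move=> qG q0 qv tv ab.
have AG : inG (2^-1) (2^-1 : R) by split; lra.
have CG : inG 2 (2^-1 : R) by split; lra.
have b0 : 0 <= qdx q 2^-1 2^-1 * 0 + qdy q 2^-1 2^-1 * 1.
  by apply: posG_dir => // ?; lra.
pose x0 := 8 / 3 * qdy q 2^-1 2^-1.
pose y0 := 2 / 3 * (qdx q 2^-1 2^-1 - 4 * qdy q 2^-1 2^-1).
have x00 : 0 <= x0 by rewrite /x0; lra.
have y00 : 0 <= y0 by rewrite /y0; lra.
have z00 : 0 <= 4 / 9 * q 2 2^-1 by have := qG _ _ CG; lra.
have sqAB : cone (fun x y : R => (x - 2^-1) ^+ 2).
  exact: (cone_swap (cone_sqAC R)).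
have h2 : 2^-1 <= (2 : R) by lra.
have h0 : (2^-1 : R) != 0 by rewrite invr_eq0 pnatr_eq0.
pose l := qABBC R.
have lE x y : l x y = _ := qABBCE x y.
have qv' : q 2^-1 2^-1^-1 = 0 by rewrite invrK.
have tv' : 2^-1 ^+ 2 * qdx q 2^-1 2^-1^-1 - qdy q 2^-1 2^-1^-1 = 0.
  by rewrite invrK; lra.
have [f0 tf] := touch_qf h0.
have l0 : l 2^-1 2^-1^-1 = 0 by rewrite invrK lE; field.
have tl : 2^-1 ^+ 2 * qdx l 2^-1 2^-1^-1 - qdy l 2^-1 2^-1^-1 = 0.
  by rewrite invrK /qdx /qdy /=; field.
have [r1 t1] := touch_qsub x0 qv' tv' f0 tf.
have [rv tr] := touch_qsub y0 r1 t1 l0 tl.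
set r := qsub (qsub q x0 (qf 2^-1)) y0 l in rv tr.
have rE x y : r x y = k20 r * (x - 2^-1) ^+ 2.
  rewrite (@critical_form_AC r 2^-1) => //; try by lra.
  - by rewrite /slope subrr mulr0 !mul0r subr0.
  - by rewrite /r !qsubE q0 qfE lE /ffun; field.
  - have -> : qdx r 2^-1 2^-1 = qdx q 2^-1 2^-1 - x0 * (3 / 2) - y0 * (3 / 2).
      by rewrite /r /qdx /=; field.
    by rewrite /x0 /y0; field.
  have -> : qdy r 2^-1 2^-1 = qdy q 2^-1 2^-1 - x0 * (3 / 8).
    by rewrite /r /qdy /=; field.
  by rewrite /x0; field.
have rC : k20 r = 4 / 9 * q 2 2^-1.
  have : r 2 2^-1 = q 2 2^-1 by rewrite /r !qsubE qfE lE /ffun; field.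
  by move=> <-; rewrite rE; field.
apply: cone_ext (coneD (coneD (coneZ x00 (cone_f (lexx _) h2))
  (coneZ y00 (cone_AB_BC R))) (coneZ z00 sqAB)) => x y.
by rewrite -rC -(rE x y) /r !qsubE qfE lE; ring.
Qed.

(** The exchange of coordinates replaces v by 1/v and reverses the comparison of derivatives at A,
    so [cone_touch_A1] applies to q or to [swapq q]; where this would need the parameter 2,
    [cone_touch_A2] takes over. *)
Lemma cone_touch_A q v : posG q -> 2^-1 <= v -> v <= 2 ->
  q 2^-1 2^-1 = 0 ->
  q v v^-1 = 0 -> v ^+ 2 * qdx q v v^-1 - qdy q v v^-1 = 0 -> cone q.
Proof.
move=> qG v1 v2 q0 qv tv; have v0 : 0 < v by lra.
have v0n : v != 0 by rewrite gt_eqF.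
have vV : v * v^-1 = 1 by rewrite divff.
have V0 : 0 < v^-1 by rewrite invr_gt0.
have sq : cone (swapq q) -> cone q.
  by move=> /cone_swap; apply: cone_ext => x y; rewrite swapqE.
have sG := posG_swap qG.
have s0 : swapq q 2^-1 2^-1 = 0 by rewrite swapqE.
have [ab|ab] := leP (v ^+ 2 * qdx q 2^-1 2^-1) (qdy q 2^-1 2^-1).
  move: v2; rewrite le_eqVlt => /orP[/eqP v2|v2]; last exact: (cone_touch_A1 qG v1 v2).
  rewrite v2 in qv tv ab.
  apply: sq; apply: cone_touch_A2 => //; rewrite ?swapqE ?qdx_swap ?qdy_swap //; lra.
move: v1; rewrite le_eqVlt => /orP[/eqP v1|v1].
  rewrite -v1 invrK in qv tv ab.
  by apply: cone_touch_A2 => //; lra.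
apply: sq; apply: (cone_touch_A1 (v := v^-1) sG) => //.
- by nra.
- by nra.
- by rewrite swapqE invrK.
- rewrite qdx_swap qdy_swap invrK.
  have -> : qdy q v v^-1 = v ^+ 2 * qdx q v v^-1 by lra.
  by rewrite mulrA -exprMn mulVf // expr1n mul1r subrr.
rewrite qdx_swap qdy_swap.
have V2 : 0 <= v^-1 ^+ 2 by exact: sqr_ge0.
have := ler_wpM2l V2 (ltW ab).
by rewrite mulrA -exprMn mulVf // expr1n mul1r.
Qed.

Lemma cone_zero_A q : posG q -> q 2^-1 2^-1 = 0 -> cone q.
Proof.
move=> qG q0.
have [||l [l0 rG rS]] := @max_sub R q (qABAC R) 1 1 qG (@posG_ABAC R).
- by split; lra.
- by rewrite qABACE mulr_gt0 //; lra.
set r := qsub _ _ _ in rG rS.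
suff cr : cone r.
  apply: cone_ext (coneD cr (coneZ l0 (cone_AB_AC R))) => x y.
  by rewrite qsubE qABACE subrK.
have r0 : r 2^-1 2^-1 = 0 by rewrite qsubE q0 qABACE; ring.
have [[x [y [xyG nc cr]]]|cA|[v [v1 v2 rv tv]]] := stuck_ABAC rG rS.
- exact: cone_critical rG xyG nc cr.
- exact: cone_critical_A.
exact: (cone_touch_A rG v1 v2).
Qed.

Lemma posG_cone q : posG q -> cone q.
Proof.
move=> qG.
have [||l [l0 rG rS]] := @max_sub R q (qGamma R) 1 2^-1 qG (@posG_Gamma R).
- by split; lra.
- by rewrite qGammaE; lra.
set r := qsub _ _ _ in rG rS.
suff cr : cone r.
  apply: cone_ext (coneD cr (coneZ l0 (cone_Gamma R))) => x y.
  by rewrite qsubE qGammaE subrK.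
have [[x [y [xyG nc cr]]]|[s [s1 s2 r0 ry]]|[s [s1 s2 r0 rx]]|r0] := stuck_Gamma rG rS.
- exact: cone_critical rG xyG nc cr.
- suff /cone_swap : cone (swapq r) by apply: cone_ext => x y; rewrite swapqE.
  by apply: (cone_double_AC (posG_swap rG) s1 s2); rewrite ?swapqE ?qdx_swap.
- exact: (cone_double_AC rG s1 s2).
exact: cone_zero_A.
Qed.

End CaseA.

(** * Positivity of the generators *)

Section Positivity.
Variable R : realType.
Local Coercion ev : quad >-> Funclass.
Implicit Types (p q r : quad R) (x y c u v w : R).

(* f_u is concave on vertical lines. *)
Lemma posG_qf u : 0 <= u -> posG (qf u).
Proof.
move=> u0 x y xyG; rewrite qfE; have [x2 y2] := inG_le2 xyG.
have [x1 y1 xy] := xyG; have x0 : 0 < x by lra.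
(* f_u = (x - 1/2)(2 - x) + s B(s) with s = y - 1/2. If B(s) < 0, moving up to Gamma only lowers the
   value, which there is (x - 1/2)(2 - x)(1 - u/x)^2. *)
pose B s := u ^+ 2 * (3 / 2 - s) - 4 * u * (x - 2^-1).
have Bmono s t : s <= t -> B t <= B s.
  by move=> st; have := ler_wpM2l (sqr_ge0 u) st; rewrite /B; lra.
pose Y := x^-1 - 2^-1.
have yY : y - 2^-1 <= Y by rewrite lerD2r -div1r ler_pdivlMr // mulrC.
have Y0 : 0 <= y - 2^-1 by lra.
have A0 : 0 <= (x - 2^-1) * (2 - x) by apply: mulr_ge0; lra.
have E0 : 0 <= (x - 2^-1) * (2 - x) + Y * B Y.
  have -> : (x - 2^-1) * (2 - x) + Y * B Y =
      (x - 2^-1) * (2 - x) * (1 - u / x) ^+ 2.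
    by rewrite /Y /B; field; rewrite gt_eqF.
  by rewrite mulr_ge0 // sqr_ge0.
have -> : ffun u x y = (x - 2^-1) * (2 - x) + (y - 2^-1) * B (y - 2^-1).
  by rewrite /ffun /B; field.
have [BY|BY] := leP 0 (B (y - 2^-1)); first by rewrite addr_ge0 // mulr_ge0.
have := Bmono _ _ yY; nra.
Qed.

(* Following the ray from (w,1/2) through a point of G up to its last point
   on AB or Gamma. *)
Lemma ray_exit w x y : 2^-1 <= w -> inG x y -> 2^-1 < y ->
  exists2 l, 1 <= l &
    inG (w + l * (x - w)) (2^-1 + l * (y - 2^-1)) /\
    (w + l * (x - w) = 2^-1 \/ (w + l * (x - w)) * (2^-1 + l * (y - 2^-1)) = 1).
Proof.
move=> w1 [x1 y1 xy] y2; have y0 : 0 < y - 2^-1 by lra.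
have IVT l0 : 1 <= l0 -> 1 <= (w + l0 * (x - w)) * (2^-1 + l0 * (y - 2^-1)) ->
    exists2 l, 1 <= l <= l0 & (w + l * (x - w)) * (2^-1 + l * (y - 2^-1)) = 1.
  move=> l01 H.
  pose P : {poly R} :=
    (w%:P + 'X * (x - w)%:P) * ((2^-1)%:P + 'X * (y - 2^-1)%:P) - 1%:P.
  have PE l : P.[l] = (w + l * (x - w)) * (2^-1 + l * (y - 2^-1)) - 1.
    by rewrite /P !hornerE.
  have [|l ll] := @poly_ivt _ P _ _ l01.
    by rewrite !PE subr_ge0 H andbT !mul1r ![_ + (_ - _)]addrC !subrK subr_le0.
  by rewrite /root PE subr_eq0 => /eqP; exists l.
have [xw|xw] := ltP x w.
  have xw0 : 0 < w - x by lra.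
  pose l0 := (w - 2^-1) / (w - x).
  have l01 : 1 <= l0 by rewrite /l0 ler_pdivlMr //; lra.
  have X0 : w + l0 * (x - w) = 2^-1 by rewrite /l0; field; rewrite gt_eqF.
  have [Y2|Y2] := leP (2^-1 + l0 * (y - 2^-1)) 2.
    exists l0 => //; split; last by left.
    have := mulr_ge0 (le_trans ler01 l01) (ltW y0).
    by rewrite X0 => H; split; lra.
  have H0 : 1 <= (w + l0 * (x - w)) * (2^-1 + l0 * (y - 2^-1)) by rewrite X0; lra.
  have [l /andP[l1 ll] lE] := IVT l0 l01 H0.
  exists l => //; split; last by right.
  split; last by rewrite lE.
    by have := ler_wpM2r (ltW xw0) ll; lra.
  by have := mulr_ge0 (le_trans ler01 l1) (ltW y0); lra.
pose l0 := 1 + 2 / (y - 2^-1).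
have l01 : 1 <= l0 by rewrite /l0 lerDl divr_ge0 // ltW.
have X l : 1 <= l -> w <= w + l * (x - w).
  by move=> l1; rewrite lerDl mulr_ge0 //; lra.
have Y l : 1 <= l -> y <= 2^-1 + l * (y - 2^-1).
  by move=> l1; have := ler_wpM2r (ltW y0) l1; lra.
have [|l /andP[l1 ll] lE] := IVT l0 l01.
  have -> : 2^-1 + l0 * (y - 2^-1) = y + 2 by rewrite /l0; field; apply/eqP; lra.
  have := X _ l01; nra.
exists l => //; split; last by right.
split; [by have := X _ l1; lra|by have := Y _ l1; lra|by rewrite lE].
Qed.

(** On a ray from (w,1/2), q is l L + l^2 M with L >= 0. Nonnegativity at the last point, where l >=
    1, gives L + l M >= 0, hence L + M >= 0 at the given point. *)
Lemma posG_star q w : 2^-1 <= w ->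
  q w 2^-1 = 0 -> qdx q w 2^-1 = 0 -> 0 <= qdy q w 2^-1 -> 0 <= k20 q ->
  (forall y, 2^-1 <= y -> y <= 2 -> 0 <= q 2^-1 y) ->
  (forall x, 2^-1 <= x -> x <= 2 -> 0 <= q x x^-1) ->
  posG q.
Proof.
move=> w1 q0 qx qy d0 HAB HG x y xyG; have [x1 y1 xy] := xyG.
have qE l : q (w + l * (x - w)) (2^-1 + l * (y - 2^-1)) =
    l * (qdy q w 2^-1 * (y - 2^-1)) + l ^+ 2 * (k20 q * (x - w) ^+ 2
      + k11 q * ((x - w) * (y - 2^-1)) + k02 q * (y - 2^-1) ^+ 2).
  by rewrite quadD q0 qx; ring.
have q1 := qE 1; rewrite !mul1r ![_ + (_ - _)]addrC !subrK expr1n mul1r in q1.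
move: y1; rewrite le_eqVlt => /orP[/eqP y1|y1].
  by rewrite q1 -y1; have := mulr_ge0 d0 (sqr_ge0 (x - w)); lra.
have [l l1 [lG H]] := ray_exit w1 xyG y1.
have : 0 <= q (w + l * (x - w)) (2^-1 + l * (y - 2^-1)).
  have [X2 Y2] := inG_le2 lG; have [X1 Y1 _] := lG.
  case: H => H; first by rewrite H; apply: HAB.
  have X0 : w + l * (x - w) != 0 by rewrite gt_eqF //; lra.
  have -> : 2^-1 + l * (y - 2^-1) = (w + l * (x - w))^-1.
    by apply: (mulfI X0); rewrite H divff.
  exact: HG.
rewrite q1 qE; set L := qdy _ _ _ * _; set M := _ + _ + _ => H2.
have L0 : 0 <= L by rewrite mulr_ge0 // subr_ge0 ltW.
have lp : 0 < l by lra.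
have H3 : 0 <= L + l * M.
  by rewrite -(pmulr_rge0 _ lp); apply: eq_ge0 H2; ring.
by have [M0|M0] := leP 0 M; [lra|nra].
Qed.

Lemma posG_qg v w : 2^-1 <= v -> v < 2 -> 2^-1 <= w -> w < (2 + 3 * v) / 4 ->
  posG (qg v w).
Proof.
move=> v1 v2 w1 wv; have v2n : 2 - v != 0 by rewrite gt_eqF // subr_gt0.
have v20 : 0 < 2 - v by rewrite subr_gt0.
(* m is the square root of [alpha_ v w], and w < (2 + 3 v) / 4 says m > 1; the factored values on AB
   and Gamma are then nonnegative. *)
pose m := 4 * (2 - w) / (3 * (2 - v)).
have m1 : 1 <= m by rewrite /m ler_pdivlMr ?mulr_gt0 //; lra.
apply: (posG_star w1).
- by rewrite qgE // gfunE //; ring.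
- by rewrite /qdx /=; field.
- have -> : qdy (qg v w) w 2^-1 = gcoef v w * (2 * v - w - v ^+ 2 / 2).
    by rewrite /qdy /=; field.
  apply: mulr_ge0; first by rewrite divr_ge0 ?sqr_ge0 // mulr_ge0 ?sqr_ge0.
  have : 0 <= (2 * v - 1) * (2 - v) by apply: mulr_ge0; lra.
  by lra.
- by rewrite /= ler01.
- move=> y y1 y2; rewrite qgE //.
  have -> : gfun v w 2^-1 y = (2 - y) * (4 / 9 * ((2 - y) * (2^-1 - w) ^+ 2)
     + (y - 2^-1) * ((m - 1) * (m * (v ^+ 2 - v + 1) - 1 + v ^+ 2))).
    by rewrite gfunE // /gcoef /slope /m; field.
  apply: mulr_ge0; first by lra.
  have P : 0 <= v ^+ 2 - v + 1 by nra.
  have V : 0 <= v * (2 * v - 1) by apply: mulr_ge0; lra.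
  have M : 0 <= m * (v ^+ 2 - v + 1) - 1 + v ^+ 2.
    by have := ler_wpM2r P m1; lra.
  apply: addr_ge0; apply: mulr_ge0; try by lra.
    by apply: mulr_ge0 (sqr_ge0 _); lra.
  by apply: mulr_ge0 => //; lra.
move=> x x1 x2; rewrite qgE //.
have x0 : x != 0 by rewrite gt_eqF //; lra.
have -> : gfun v w x x^-1 =
    (x - v) ^+ 2 * (x - 2^-1) * (x + 3 / 2 * m ^+ 2 - 2) / x ^+ 2.
  by rewrite gfunE // /gcoef /slope /m; field; rewrite x0.
have M : 1 <= m ^+ 2 by nra.
apply: divr_ge0 (sqr_ge0 _); apply: mulr_ge0; last by lra.
by apply: mulr_ge0 (sqr_ge0 _) _; lra.
Qed.

End Positivity.

(** * Extremality of the generators *)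

Section Extremality.
Variable R : realType.
Local Coercion ev : quad >-> Funclass.
Implicit Types (p q r : quad R) (x y c u v w : R).

Definition qadd q1 q2 : quad R :=
  Quad (k00 q1 + k00 q2) (k10 q1 + k10 q2) (k01 q1 + k01 q2)
       (k20 q1 + k20 q2) (k11 q1 + k11 q2) (k02 q1 + k02 q2).

Lemma qaddE q1 q2 x y : qadd q1 q2 x y = q1 x y + q2 x y.
Proof. by rewrite /ev /=; ring. Qed.

Lemma qdx_add q1 q2 x y : qdx (qadd q1 q2) x y = qdx q1 x y + qdx q2 x y.
Proof. by rewrite /qdx /=; ring. Qed.

Lemma qdy_add q1 q2 x y : qdy (qadd q1 q2) x y = qdy q1 x y + qdy q2 x y.
Proof. by rewrite /qdy /=; ring. Qed.

(** The other summand follows by symmetry, and c >= 0 follows from a point of G where q > 0. *)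
Definition extremal q := forall q1 q2, posG q1 -> posG q2 -> q = qadd q1 q2 ->
  exists c, forall x y, q1 x y = c * q x y.

Lemma extremal_swap q : extremal q -> extremal (swapq q).
Proof.
move=> eq q1 q2 G1 G2 E.
have [|c cE] := eq _ _ (posG_swap G1) (posG_swap G2).
  by rewrite -[q]swapqK E.
by exists c => x y; rewrite swapqE -cE swapqE.
Qed.

(* A sum of nonnegative derivatives of q1 and q2 vanishes only if both do. *)
Section Summands.
Variables (q q1 q2 : quad R).
Hypotheses (G1 : posG q1) (G2 : posG q2) (qE : q = qadd q1 q2).

Lemma summand_zero x y : inG x y -> q x y = 0 -> q1 x y = 0 /\ q2 x y = 0.
Proof.
move=> xyG; rewrite qE qaddE => H.
by have := G1 xyG; have := G2 xyG; split; lra.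
Qed.

Lemma summand_dir x y u v : inG x y -> q x y = 0 ->
  (x = 2^-1 -> 0 <= u) -> (y = 2^-1 -> 0 <= v) ->
  (x * y = 1 -> u * y + v * x < 0 \/ (u * y + v * x = 0 /\ u * v <= 0)) ->
  qdx q x y * u + qdy q x y * v = 0 ->
  qdx q1 x y * u + qdy q1 x y * v = 0 /\ qdx q2 x y * u + qdy q2 x y * v = 0.
Proof.
move=> xyG q0 Hx Hy Hxy; have [q10 q20] := summand_zero xyG q0.
rewrite qE qdx_add qdy_add => H.
have := posG_dir G1 xyG q10 Hx Hy Hxy; have := posG_dir G2 xyG q20 Hx Hy Hxy.
by split; lra.
Qed.

(** Directions into the square [1/2,3/4]^2 are admissible from every point of G, corners included,
    and suffice to annihilate the gradient. *)
Lemma summand_critical x y : inG x y -> critical q x y -> critical q1 x y.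
Proof.
move=> xyG [q0 qx qy]; have [q10 q20] := summand_zero xyG q0.
have [] : qdx q1 x y = 0 /\ qdy q1 x y = 0; last by split.
apply: grad_eq0 => z t zh th.
have := grad_ge0 G1 xyG q10 zh th; have := grad_ge0 G2 xyG q20 zh th.
by move: qx qy; rewrite qE qdx_add qdy_add; nra.
Qed.

Lemma summand_tangent v : 2^-1 <= v -> v <= 2 -> q v v^-1 = 0 ->
  v ^+ 2 * qdx q v v^-1 - qdy q v v^-1 = 0 ->
  v ^+ 2 * qdx q1 v v^-1 - qdy q1 v v^-1 = 0 /\
  v ^+ 2 * qdx q2 v v^-1 - qdy q2 v v^-1 = 0.
Proof.
move=> v1 v2 qv tv; have vG := inG_Gamma v1 v2; have v0 : v != 0 by rewrite gt_eqF //; lra.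
have E : v ^+ 2 * v^-1 = v by field.
have S := sqr_ge0 v.
(* At C only the tangent direction of increasing y stays in G; for v < 2 the opposite one is
   used. *)
move: v2; rewrite le_eqVlt => /orP[/eqP v2|v2].
  have [||||] := summand_dir (u := - v ^+ 2) (v := 1) vG qv.
  - by move=> H; lra.
  - by [].
  - by move=> _; right; rewrite mulNr E; lra.
  - lra.
  by split; lra.
have Vh : v^-1 = 2^-1 -> 0 <= -1 :> R by move/invr_inj; lra.
have [||||] := summand_dir (u := v ^+ 2) (v := -1) vG qv.
- by [].
- exact: Vh.
- by move=> _; right; rewrite E; lra.
- lra.
by split; lra.
Qed.

End Summands.

Definition qsq a b c : quad R :=
  Quad (a ^+ 2) (2 * a * b) (2 * a * c) (b ^+ 2) (2 * b * c) (c ^+ 2).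

Lemma qsqE a b c x y : qsq a b c x y = (a + b * x + c * y) ^+ 2.
Proof. by rewrite /ev /=; ring. Qed.

(** The gradient of q1 vanishes at both points, so its Hessian annihilates their difference (u,v),
    and q1 is a multiple of the squared line through them. *)
Lemma extremal_qsq a b c x y x' y' : (b != 0) || (c != 0) ->
  inG x y -> inG x' y' -> (x != x') || (y != y') ->
  a + b * x + c * y = 0 -> a + b * x' + c * y' = 0 -> extremal (qsq a b c).
Proof.
move=> bc xyG xyG' xy l0 l0' q1 q2 G1 G2 E.
have crit z t : a + b * z + c * t = 0 -> critical (qsq a b c) z t.
  move=> H; split; first by rewrite qsqE H expr0n.
    have -> : qdx (qsq a b c) z t = 2 * b * (a + b * z + c * t).
      by rewrite /qdx /=; ring.
    by rewrite H mulr0.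
  have -> : qdy (qsq a b c) z t = 2 * c * (a + b * z + c * t).
    by rewrite /qdy /=; ring.
  by rewrite H mulr0.
have cr := summand_critical G1 G2 E xyG (crit _ _ l0).
have [_ qx' qy'] := summand_critical G1 G2 E xyG' (crit _ _ l0').
have [_ qx qy] := cr.
pose u := x' - x; pose v := y' - y.
have lv : b * u + c * v = 0 by rewrite /u /v; lra.
have k1 : 2 * k20 q1 * u + k11 q1 * v = 0 by move: qx qx'; rewrite /qdx /u /v; lra.
have k2 : k11 q1 * u + 2 * k02 q1 * v = 0 by move: qy qy'; rewrite /qdy /u /v; lra.
have D0 : u ^+ 2 + v ^+ 2 != 0.
  rewrite paddr_eq0 ?sqr_ge0 // !sqrf_eq0 !subr_eq0 negb_and.
  by rewrite ![_ == x]eq_sym ![_ == y]eq_sym.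
have B0 : b ^+ 2 + c ^+ 2 != 0 by rewrite paddr_eq0 ?sqr_ge0 // !sqrf_eq0 negb_and.
pose s := (b * v - c * u) / (u ^+ 2 + v ^+ 2).
have bE : b = s * v.
  apply: (mulIf D0); rewrite /s mulrAC divfK //.
  have : c * u * v = - b * u * u by have := congr1 ( *%R u) lv; lra.
  lra.
have cE : c = - s * u.
  apply: (mulIf D0); rewrite /s mulNr mulrAC mulNr divfK //.
  have : b * u * v = - c * v * v by have := congr1 ( *%R v) lv; lra.
  lra.
have s0 : s != 0.
  by apply: contra B0 => /eqP s0; rewrite bE cE s0 oppr0 !mul0r expr0n addr0.
have aE : a = - b * x - c * y by lra.
exists ((k20 q1 + k02 q1) / ((u ^+ 2 + v ^+ 2) * s ^+ 2)) => z t.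
have e1 : k20 q1 * (u ^+ 2 + v ^+ 2) = (k20 q1 + k02 q1) * v ^+ 2.
  by have := congr1 ( *%R u) k1; have := congr1 ( *%R v) k2; lra.
have e2 : k02 q1 * (u ^+ 2 + v ^+ 2) = (k20 q1 + k02 q1) * u ^+ 2.
  by have := congr1 ( *%R u) k1; have := congr1 ( *%R v) k2; lra.
have e3 : k11 q1 * (u ^+ 2 + v ^+ 2) = - 2 * (k20 q1 + k02 q1) * u * v.
  by have := congr1 ( *%R v) k1; have := congr1 ( *%R u) k2; lra.
apply: (mulIf D0); rewrite (criticalE _ _ cr) qsqE aE bE cE.
set K := k20 q1 + k02 q1 in e1 e2 e3 *.
transitivity (K * (v * (z - x) - u * (t - y)) ^+ 2).
  have -> : forall A B C D X Y : R, (A * X ^+ 2 + B * (X * Y) + C * Y ^+ 2) * D =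
    (A * D) * X ^+ 2 + (B * D) * (X * Y) + (C * D) * Y ^+ 2 by move=> *; ring.
  by rewrite e1 e2 e3; ring.
by field; rewrite s0 D0.
Qed.

Lemma quad_zero_AB q : q 2^-1 2^-1 = 0 -> q 2^-1 1 = 0 -> q 2^-1 2 = 0 ->
  [/\ k02 q = 0, k01 q = - k11 q / 2 & k00 q = - k10 q / 2 - k20 q / 4].
Proof. by rewrite /ev; split; lra. Qed.

Lemma inG_AB y : 2^-1 <= y -> y <= 2 -> inG 2^-1 y.
Proof. by split; lra. Qed.

Lemma inG_AC x : 2^-1 <= x -> x <= 2 -> inG x 2^-1.
Proof. by split; lra. Qed.

(** The zeros along AB make [l_AB] a factor of q1; the gradient at B and the zero at C make the
    other factor vanish at B and C. *)
Lemma extremal_qABBC : extremal (qABBC R).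
Proof.
move=> q1 q2 G1 G2 E.
have Z x y : inG x y -> qABBC R x y = 0 -> q1 x y = 0.
  by move=> xyG H; have [] := summand_zero G1 G2 E xyG H.
have [] := @quad_zero_AB q1.
- by apply: Z; [apply: inG_AB; lra|rewrite qABBCE; ring].
- by apply: Z; [apply: inG_AB; lra|rewrite qABBCE; ring].
- by apply: Z; [apply: inG_AB; lra|rewrite qABBCE; ring].
have qC : q1 2 2^-1 = 0 by apply: Z; [apply: inG_AC; lra|rewrite qABBCE; field].
have [] : critical q1 2^-1 2.
  apply: (summand_critical G1 G2 E); first by apply: inG_AB; lra.
  by split; rewrite ?qABBCE /qdx /qdy /=; field.
move=> _ qx _ E1 E2 E3; rewrite /qdx in qx; rewrite /ev in qC.
exists (- k20 q1) => x y; rewrite qABBCE /ev E1 E2 E3.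
have -> : k11 q1 = k20 q1 by move: qC qx; rewrite E1 E2 E3; lra.
have -> : k10 q1 = -3 * k20 q1 by move: qC qx; rewrite E1 E2 E3; lra.
by field.
Qed.

Lemma extremal_qABAC : extremal (qABAC R).
Proof.
move=> q1 q2 G1 G2 E.
have Z x y : inG x y -> qABAC R x y = 0 -> q1 x y = 0.
  by move=> xyG H; have [] := summand_zero G1 G2 E xyG H.
have [] := @quad_zero_AB q1.
- by apply: Z; [apply: inG_AB; lra|rewrite qABACE; ring].
- by apply: Z; [apply: inG_AB; lra|rewrite qABACE; ring].
- by apply: Z; [apply: inG_AB; lra|rewrite qABACE; ring].
have q1C : q1 1 2^-1 = 0 by apply: Z; [apply: inG_AC; lra|rewrite qABACE; ring].
have q2C : q1 2 2^-1 = 0 by apply: Z; [apply: inG_AC; lra|rewrite qABACE; ring].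
move=> E1 E2 E3; rewrite /ev in q1C q2C.
exists (k11 q1) => x y; rewrite qABACE /ev E1 E2 E3.
have -> : k20 q1 = 0 by move: q1C q2C; rewrite E1 E2 E3; lra.
have -> : k10 q1 = - k11 q1 / 2 by move: q1C q2C; rewrite E1 E2 E3; lra.
by field.
Qed.

(** Five zeros on Gamma leave only the multiples of 1 - x y. *)
Lemma extremal_qGamma : extremal (qGamma R).
Proof.
move=> q1 q2 G1 G2 E.
have Z x : 2^-1 <= x -> x <= 2 -> q1 x x^-1 = 0.
  move=> x1 x2; have [|//] := summand_zero G1 G2 E (inG_Gamma x1 x2).
  by rewrite qGammaE divff ?subrr // gt_eqF //; lra.
have Z1 : q1 1 1 = 0 by rewrite -{2}invr1; apply: Z; lra.
have Z2 : q1 2 2^-1 = 0 by apply: Z; lra.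
have Z3 : q1 2^-1 2 = 0 by rewrite -{2}[2]invrK; apply: Z; lra.
have Z4 : q1 (4 / 5) (5 / 4) = 0.
  by rewrite (_ : 5 / 4 = (4 / 5)^-1); [apply: Z; lra|field].
have Z5 : q1 (5 / 4) (4 / 5) = 0.
  by rewrite (_ : 4 / 5 = (5 / 4)^-1); [apply: Z; lra|field].
exists (k00 q1) => x y; rewrite qGammaE.
move: Z1 Z2 Z3 Z4 Z5; rewrite /ev.
case: (q1) => a b c d e f /= *.
have -> : b = 0 by lra.
have -> : c = 0 by lra.
have -> : d = 0 by lra.
have -> : f = 0 by lra.
have -> : e = - a by lra.
by ring.
Qed.

(** The zeros at A, B, C are inherited, which leaves a factor r on Gamma. For f_u it is (t - u)^2, a
    sum of two such factors nonnegative on (1/2,2); both have a double root at u. *)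
Lemma extremal_qf u : 2^-1 <= u -> u <= 2 -> extremal (qf u).
Proof.
move=> u1 u2 q1 q2 G1 G2 E.
have Z x y : inG x y -> ffun u x y = 0 -> q1 x y = 0 /\ q2 x y = 0.
  by move=> xyG H; apply: (summand_zero G1 G2 E xyG); rewrite qfE.
have [A1 A2] : q1 2^-1 2^-1 = 0 /\ q2 2^-1 2^-1 = 0.
  by apply: Z; [apply: inG_AB; lra|rewrite /ffun; ring].
have [B1 B2] : q1 2^-1 2 = 0 /\ q2 2^-1 2 = 0.
  by apply: Z; [apply: inG_AB; lra|rewrite /ffun; ring].
have [C1 C2] : q1 2 2^-1 = 0 /\ q2 2 2^-1 = 0.
  by apply: Z; [apply: inG_AC; lra|rewrite /ffun; ring].
(* On Gamma, q(t,1/t) = (t - 1/2) (2 - t) r(t) / t^2. *)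
pose r q t := - k20 q * t ^+ 2 + k11 q / 2 * t - k02 q.
have rE q t : q 2^-1 2^-1 = 0 -> q 2^-1 2 = 0 -> q 2 2^-1 = 0 -> t != 0 ->
    q t t^-1 = (t - 2^-1) * (2 - t) / t ^+ 2 * r q t.
  move=> qA qB qC t0.
  have E1 : k10 q = - (5 / 2) * k20 q - k11 q / 2 by move: qA qC; rewrite /ev; lra.
  have E2 : k01 q = - (5 / 2) * k02 q - k11 q / 2 by move: qA qB; rewrite /ev; lra.
  have E3 : k00 q = k20 q + k02 q + k11 q / 4 by move: qA qB qC; rewrite /ev; lra.
  by rewrite /ev /r E1 E2 E3; field.
have r0 q t : posG q -> q 2^-1 2^-1 = 0 -> q 2^-1 2 = 0 -> q 2 2^-1 = 0 ->
    2^-1 < t -> t < 2 -> 0 <= r q t.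
  move=> qG qA qB qC t1 t2.
  have P : 0 < (t - 2^-1) * (2 - t) / t ^+ 2.
    by rewrite divr_gt0 ?mulr_gt0 ?exprn_gt0 //; lra.
  rewrite -(pmulr_rge0 _ P) -rE //; first by apply/qG/inG_Gamma; lra.
  by rewrite gt_eqF //; lra.
have rS t : r q1 t + r q2 t = (t - u) ^+ 2.
  have -> : (t - u) ^+ 2 = r (qf u) t by rewrite /r /=; field.
  by rewrite E /r /=; field.
(* sg points from u into (1/2,2), endpoints included; the one-sided derivatives d are nonnegative
   and add up to 0. *)
pose sg : R := if u < 2 then 1 else -1.
have sg2 : sg ^+ 2 = 1 by rewrite /sg; case: ifP => _; rewrite ?sqrrN expr1n.
have sm : for_small (fun s => 2^-1 < u + s * sg /\ u + s * sg < 2).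
  rewrite /sg; case: ltP => u2'.
    exists ((2 - u) / 2); first by lra.
    by move=> s /andP[s0 s1]; split; lra.
  exists 1; first exact: ltr01.
  by move=> s /andP[s0 s1]; split; lra.
pose d q := (- 2 * k20 q * u + k11 q / 2) * sg.
have rT q s : r q (u + s * sg) = r q u + s * d q + s ^+ 2 * (- k20 q).
  rewrite /r /d.
  have -> : (u + s * sg) ^+ 2 = u ^+ 2 + 2 * u * s * sg + s ^+ 2 * sg ^+ 2 by ring.
  by rewrite sg2; ring.
have ru q : posG q -> q 2^-1 2^-1 = 0 -> q 2^-1 2 = 0 -> q 2 2^-1 = 0 -> 0 <= r q u.
  move=> qG qA qB qC; apply: (@for_small_quad_ge0 _ _ (d q) (- k20 q)).
  by apply: for_smallS sm => s s0 [t1 t2]; rewrite -rT; exact: r0.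
have ru1 := ru _ G1 A1 B1 C1; have ru2 := ru _ G2 A2 B2 C2.
have := rS u; rewrite subrr expr0n /= => ru0.
have du q : posG q -> q 2^-1 2^-1 = 0 -> q 2^-1 2 = 0 -> q 2 2^-1 = 0 ->
    r q u = 0 -> 0 <= d q.
  move=> qG qA qB qC qu; apply: (@for_small_ge0 _ _ (- k20 q)).
  apply: for_smallS sm => s s0 [t1 t2]; have := r0 q _ qG qA qB qC t1 t2.
  rewrite rT qu add0r => H; rewrite -(pmulr_rge0 _ s0); apply: eq_ge0 H; ring.
have r1 : r q1 u = 0 by lra.
have r2 : r q2 u = 0 by lra.
have d1 := du _ G1 A1 B1 C1 r1; have d2 := du _ G2 A2 B2 C2 r2.
have dS : d q1 + d q2 = 0.
  have -> : d q1 + d q2 = d (qf u) by rewrite E /d /=; field.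
  by rewrite /d /=; field.
have d0 : d q1 = 0 by lra.
have sg0 : sg != 0 by rewrite -sqrf_eq0 sg2 oner_neq0.
have E4 : k11 q1 = 4 * k20 q1 * u.
  by move/eqP: d0; rewrite /d mulf_eq0 (negbTE sg0) orbF => /eqP; lra.
have E5 : k02 q1 = k20 q1 * u ^+ 2 by move: r1; rewrite /r E4; lra.
have E1 : k10 q1 = - (5 / 2) * k20 q1 - k11 q1 / 2 by move: A1 C1; rewrite /ev; lra.
have E2 : k01 q1 = - (5 / 2) * k02 q1 - k11 q1 / 2 by move: A1 B1; rewrite /ev; lra.
have E3 : k00 q1 = k20 q1 + k02 q1 + k11 q1 / 4 by move: A1 B1 C1; rewrite /ev; lra.
by exists (- k20 q1) => x y; rewrite qfE /ev E1 E2 E3 E5 E4 /ffun; field.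
Qed.

(** Both summands lie in the pencil of [touch_AC]. The nonnegative coefficient of [touch_AC_B] is
    zero for g1_{v,w}, hence for both, and fixes n1 in terms of [k20 q1]. *)
Lemma extremal_qg v w : 2^-1 <= v -> v < 2 -> 2^-1 <= w -> w < (2 + 3 * v) / 4 ->
  extremal (qg v w).
Proof.
move=> v1 v2 w1 wv q1 q2 G1 G2 E.
have v0 : v != 0 by rewrite gt_eqF //; lra.
have vG := inG_Gamma v1 (ltW v2).
have wG : inG w 2^-1 by apply: inG_AC; lra.
have [g0 tg] := touch_qg w v0 v2.
have [r1 r2] := summand_zero G1 G2 E vG g0.
have [t1 t2] := summand_tangent G1 G2 E v1 (ltW v2) g0 tg.
have p0 : qg v w w 2^-1 = 0 by rewrite qgE // gfunE //; ring.
have [p1 p2] := summand_zero G1 G2 E wG p0.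
have [||||x1 x2] := summand_dir G1 G2 E (u := 1) (v := 0) wG p0.
- by move=> _; exact: ler01.
- by [].
- by lra.
- by rewrite /qdx /=; field.
rewrite !mulr1 !mulr0 !addr0 in x1 x2.
have [n1 [_ E1]] := touch_AC v1 v2 p1 x1 r1 t1.
have [n2 [_ E2]] := touch_AC v1 v2 p2 x2 r2 t2.
have k11E q : k11 q = q 1 1 - q 1 0 - q 0 1 + q 0 0 by rewrite /ev; ring.
have nS : n1 + n2 = - gcoef v w.
  have : k11 (qg v w) = k11 q1 + k11 q2 by rewrite E.
  have : k20 (qg v w) = k20 q1 + k20 q2 by rewrite E.
  rewrite (k11E q1) (k11E q2) !E1 !E2 /= => kS.
  have -> : k20 q2 = 1 - k20 q1 by lra.
  lra.
have kS : k20 q1 + k20 q2 = 1 by have : k20 (qg v w) = k20 q1 + k20 q2 by rewrite E.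
have b1 := touch_AC_B G1 v1 v2 E1; have b2 := touch_AC_B G2 v1 v2 E2.
have N : gcoef v w * (k20 q1 + k20 q2) = gcoef v w by rewrite kS mulr1.
have nE : n1 = - k20 q1 * gcoef v w by lra.
by exists (k20 q1) => x y; rewrite E1 nE qgE // gfunE //; ring.
Qed.

End Extremality.

(** * Generators as extreme rays, and the cone as their hull *)

Section Main.
Variable R : realType.
Local Coercion ev : quad >-> Funclass.
Implicit Types (p : {mpoly R[2]}) (q : quad R) (x y c u v w : R).
Local Notation K := (nonneg_quadratics (@region R)).

Lemma to_mpoly_add q q' : to_mpoly (qadd q q') = to_mpoly q + to_mpoly q'.
Proof. by rewrite /to_mpoly /= -!mul_mpolyC; ring. Qed.

Lemma nonneg_quadraticsD p p' : K p -> K p' -> K (p + p').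
Proof.
move=> [s3 H] [s3' H']; split=> [|x xG].
  by apply: leq_trans (msizeD_le _ _) _; rewrite geq_max s3.
by rewrite mevalD addr_ge0 ?H ?H'.
Qed.

Lemma nonneg_quadraticsZ c p : 0 <= c -> K p -> K (c *: p).
Proof.
move=> c0 [s3 H]; split=> [|x xG]; first exact: leq_trans (msizeZ_le _ _) _.
by rewrite mevalZ mulr_ge0 ?H.
Qed.

Lemma nonneg_quadratics0 : K 0.
Proof. by split=> [|x _]; rewrite ?msize0 ?meval0. Qed.

Lemma to_mpoly_comp q : to_mpoly q \mPo [tuple X2 R; X1 R] = to_mpoly (swapq q).
Proof.
have E1 : X1 R \mPo [tuple X2 R; X1 R] = X2 R by rewrite comp_mpolyXU.
have E2 : X2 R \mPo [tuple X2 R; X1 R] = X1 R by rewrite comp_mpolyXU.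
rewrite /to_mpoly !comp_mpolyD !comp_mpolyZ !rmorphXn !rmorphM /= E1 E2 comp_mpolyC.
by rewrite -!mul_mpolyC; ring.
Qed.

Lemma affineM a b c a' b' c' : affine a b c * affine a' b' c' =
  to_mpoly (Quad (a * a') (a * b' + b * a') (a * c' + c * a')
                 (b * b') (b * c' + c * b') (c * c') : quad R).
Proof. by rewrite /affine /to_mpoly /= -!mul_mpolyC; ring. Qed.

Lemma l_AB_affine : l_AB R = affine (- 2^-1) 1 0.
Proof. by rewrite /l_AB /affine -!mul_mpolyC; ring. Qed.
Lemma l_AC_affine : l_AC R = affine (- 2^-1) 0 1.
Proof. by rewrite /l_AC /affine -!mul_mpolyC; ring. Qed.
Lemma l_BC_affine : l_BC R = affine (5 / 2) (-1) (-1).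
Proof. by rewrite /l_BC /affine -!mul_mpolyC; ring. Qed.

Definition deg2 p := (msize p <= 3)%N.

Lemma deg2D p p' : deg2 p -> deg2 p' -> deg2 (p + p').
Proof.
by move=> H H'; apply: leq_trans (msizeD_le _ _) _; rewrite geq_max; apply/andP.
Qed.

Lemma deg2Z c p : deg2 p -> deg2 (c *: p).
Proof. exact: leq_trans (msizeZ_le _ _). Qed.

Lemma deg2_affineM a b c a' b' c' : deg2 (affine a b c * affine a' b' c').
Proof. by rewrite affineM; exact: msize_to_mpoly. Qed.

Lemma deg2_f u : deg2 (f_ u).
Proof.
have E1 : 2%:MP - X1 R = affine 2 (-1) 0 by rewrite /affine -!mul_mpolyC; ring.
have E2 : 2%:MP - X2 R = affine 2 0 (-1) by rewrite /affine -!mul_mpolyC; ring.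
rewrite /f_ E1 E2 l_AB_affine l_AC_affine -scaleNr.
by do ?[apply: deg2D|apply: deg2Z]; exact: deg2_affineM.
Qed.

Lemma deg2_Gamma : deg2 (l_Gamma R).
Proof.
have -> : l_Gamma R = to_mpoly (qGamma R).
  by rewrite /l_Gamma /to_mpoly /= -!mul_mpolyC; ring.
exact: msize_to_mpoly.
Qed.

Lemma deg2_g1 v w : deg2 (g1_ v w).
Proof.
have E : X1 R + (v / 2) *: X2 R - v%:MP - (2^-1)%:MP = affine (- v - 2^-1) 1 (v / 2).
  by rewrite /affine -!mul_mpolyC; ring.
rewrite /g1_ E expr2.
apply: deg2D; [apply: deg2D; apply: deg2Z|apply: deg2Z];
  [exact: deg2_affineM|exact: deg2_f|exact: deg2_Gamma].
Qed.

Lemma deg2_quadE p q : deg2 p -> (forall x y, evm p x y = q x y) -> p = to_mpoly q.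
Proof.
move=> /to_mpolyP[q' ->] H; congr to_mpoly; apply: ev_inj => x y.
by rewrite -H evm_to_mpoly.
Qed.

Lemma extremal_square (l : {mpoly R[2]}) : l != 0 -> (msize l <= 2)%N ->
  (exists x y : 'rV[R]_2, [/\ region x, region y, x != y,
                               l.@[x 0] = 0 & l.@[y 0] = 0]) ->
  exists q x y, [/\ l ^+ 2 = to_mpoly q, posG q, extremal q, inG x y & 0 < q x y].
Proof.
move=> l0 /affineP[a [b [c lE]]] [z [t [zG tG zt]]].
rewrite -(ptK z) -(ptK t) -!/(evm _ _ _) lE !evm_affine => lz lt.
exists (qsq a b c).
have bc : (b != 0) || (c != 0).
  rewrite -negb_and; apply: contra l0 => /andP[/eqP b0 /eqP c0].
  move: lz; rewrite lE b0 c0 !mul0r !addr0 => ->.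
  by rewrite /affine -!mul_mpolyC; apply/eqP; ring.
have [x [y [xyG xy0]]] : exists x y, inG x y /\ a + b * x + c * y != 0.
  apply: contrapT => H; move: bc; rewrite -negb_and; apply/negP/negPn.
  have E x y : inG x y -> a + b * x + c * y = 0.
    by move=> xyG; apply/eqP/negPn/negP => xy0; apply: H; exists x, y.
  have EA := E _ _ (inG_AB (y := 2^-1) ltac:(lra) ltac:(lra)).
  have EB := E _ _ (inG_AB (y := 2) ltac:(lra) ltac:(lra)).
  have EC := E _ _ (inG_AC (x := 2) ltac:(lra) ltac:(lra)).
  by apply/andP; split; apply/eqP; lra.
exists x, y; split=> //.
- by rewrite expr2 affineM; congr to_mpoly; rewrite /qsq; congr Quad; ring.
- by move=> *; rewrite qsqE sqr_ge0.
- apply: (extremal_qsq bc (x := z 0 0) (y := z 0 1) (x' := t 0 0) (y' := t 0 1)) => //.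
  + by apply/regionE; rewrite ptK.
  + by apply/regionE; rewrite ptK.
  rewrite -negb_and; apply: contra zt => /andP[/eqP E0 /eqP E1].
  by rewrite -(ptK z) -(ptK t) E0 E1.
by rewrite qsqE lt_neqAle eq_sym sqrf_eq0 xy0 sqr_ge0.
Qed.

(** The point with q > 0 shows later that p is nonzero and that the multipliers are nonnegative. *)
Lemma generator_extremal p : generator p ->
  exists q x y, [/\ p = to_mpoly q, posG q, extremal q, inG x y & 0 < q x y].
Proof.
have ABBC : l_AB R * l_BC R = to_mpoly (qABBC R).
  apply: deg2_quadE; first by rewrite l_AB_affine l_BC_affine; exact: deg2_affineM.
  by move=> x y; rewrite qABBCE !evmE.
have ABBCpos : posG (qABBC R).
  by move=> x y [x1 y1 xy]; rewrite qABBCE; apply: mulr_ge0; clear -x1 y1 xy; nra.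
have g1E v w : v < 2 -> g1_ v w = to_mpoly (qg v w).
  move=> v2; apply: deg2_quadE; first exact: deg2_g1.
  by move=> x y; rewrite evm_g1 qgE.
have gC v w : v < 2 -> w < (2 + 3 * v) / 4 -> 0 < qg v w 2 2^-1.
  move=> v2 wv; rewrite qgE // gfunE //.
  have -> : (2 - w - slope v w * (2^-1 - 2^-1)) ^+ 2 -
    gcoef v w * ((2^-1 - 2^-1) * (2 + v ^+ 2 * 2^-1 - 2 * v)) = (2 - w) ^+ 2 by ring.
  by rewrite exprn_gt0 //; lra.
have GC : inG 2 (2^-1 : R) by apply: inG_AC; lra.
case=> [l l0 l2 H|||||u u1 u2|v w v1 v2 w1 w2|v w v1 v2 w1 w2].
- exact: extremal_square.
- exists (qABBC R), 1, 2^-1; split=> //; first exact: extremal_qABBC.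
    by apply: inG_AC; lra.
  by rewrite qABBCE mulr_gt0 //; lra.
- exists (swapq (qABBC R)), 2^-1, 1; split=> //.
  + apply: deg2_quadE; first by rewrite l_AC_affine l_BC_affine; exact: deg2_affineM.
    by move=> x y; rewrite swapqE qABBCE !evmE; ring.
  + exact: posG_swap.
  + exact/extremal_swap/extremal_qABBC.
  + by apply: inG_AB; lra.
  by rewrite swapqE qABBCE mulr_gt0 //; lra.
- exists (qABAC R), 1, 1; split=> //.
  + apply: deg2_quadE; first by rewrite l_AB_affine l_AC_affine; exact: deg2_affineM.
    by move=> x y; rewrite qABACE !evmE.
  + exact: posG_ABAC.
  + exact: extremal_qABAC.
  + by split; lra.
  by rewrite qABACE mulr_gt0 //; lra.
- exists (qGamma R), 2^-1, 2^-1; split=> //.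
  + apply: deg2_quadE; first exact: deg2_Gamma.
    by move=> x y; rewrite qGammaE !evmE.
  + exact: posG_Gamma.
  + exact: extremal_qGamma.
  + by split; lra.
  by rewrite qGammaE; lra.
- exists (qf u), 1, 2^-1; split=> //.
  + apply: deg2_quadE; first exact: deg2_f.
    by move=> x y; rewrite evm_f qfE.
  + by apply: posG_qf; lra.
  + exact: extremal_qf.
  + by apply: inG_AC; lra.
  by rewrite qfE /ffun; lra.
- exists (qg v w), 2, 2^-1; split=> //; first exact: g1E.
  + exact: posG_qg.
  + exact: extremal_qg.
  exact: gC.
exists (swapq (qg v w)), 2^-1, 2; split=> //.
- by rewrite /g2_ g1E // to_mpoly_comp.
- exact/posG_swap/posG_qg.
- exact/extremal_swap/extremal_qg.
- exact: inG_sym.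
by rewrite swapqE; exact: gC.
Qed.

Lemma generator_nonneg p : generator p -> K p.
Proof.
by move=> /generator_extremal[q [x [y [-> qG _ _ _]]]];
  apply/nonneg_quadraticsP; exists q.
Qed.

(** The predicate P covers a full sum, a single term and a sum with one term removed. *)
Lemma sum_nonneg n (P : pred 'I_n) (c : 'I_n -> R) (F : 'I_n -> {mpoly R[2]}) :
  (forall i, 0 <= c i) -> (forall i, (\bigcup_(q in @generator R) ray q) (F i)) ->
  K (\sum_(i < n | P i) c i *: F i).
Proof.
move=> c0 GF; apply: big_ind => [||i _].
- exact: nonneg_quadratics0.
- by move=> *; exact: nonneg_quadraticsD.
have [g /generator_nonneg Kg [d /= d0 <-]] := GF i.
by apply: nonneg_quadraticsZ => //; exact: nonneg_quadraticsZ.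
Qed.

Lemma nonneg_hull : K = @hull R.
Proof.
apply/seteqP; split=> p => [Kp|[n [c [F [c0 GF ->]]]]]; last exact: sum_nonneg.
have [q pE qG] := (nonneg_quadraticsP p).1 Kp.
have [p' hp' H] := posG_cone qG.
suff -> : p = p' by [].
have Kp' : K p' by case: hp' => n [c [F [c0 GF ->]]]; exact: sum_nonneg.
apply: evm_inj => [||x y]; [exact: Kp.1|exact: Kp'.1|].
by rewrite -H pE evm_to_mpoly.
Qed.

Lemma generator_spans p : generator p -> spans_extreme_ray K p.
Proof.
move=> gp; have [q [x [y [pE qG qe xyG q0]]]] := generator_extremal gp.
have H p1 p2 : K p1 -> K p2 -> p = p1 + p2 -> exists2 c : R, 0 <= c & p1 = c *: p.
  move=> /nonneg_quadraticsP[q1 E1 G1] /nonneg_quadraticsP[q2 E2 G2] E.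
  have [|c cE] := qe q1 q2 G1 G2.
    apply: ev_inj => a b; rewrite -!evm_to_mpoly -pE to_mpoly_add -E1 -E2.
    by rewrite E.
  exists c; first by rewrite -(pmulr_lge0 _ q0) -cE; exact: G1.
  apply: evm_inj => [||a b].
  - by rewrite E1; exact: msize_to_mpoly.
  - by rewrite pE; apply: leq_trans (msizeZ_le _ _) (msize_to_mpoly _).
  by rewrite evmZ E1 pE !evm_to_mpoly cE.
split; first exact: generator_nonneg.
  by apply: contraTneq q0 => p0; rewrite -evm_to_mpoly -pE p0 evm0 ltxx.
move=> p1 p2 K1 K2 E; split; first exact: (H p1 p2).
by apply: (H p2 p1) => //; rewrite addrC.
Qed.

Lemma ray_scale c p : 0 < c -> ray (c *: p) = ray p.
Proof.
move=> c0; apply/seteqP; split=> _ [d /= d0 <-].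
  by exists (d * c); rewrite ?scalerA //= mulr_ge0 // ltW.
exists (d / c); first by rewrite /= divr_ge0 // ltW.
by rewrite scalerA divfK // gt_eqF.
Qed.

(** Some term of a decomposition of p into generators is nonzero; extremality makes it a positive
    multiple of p. *)
Lemma spans_generator p : spans_extreme_ray K p ->
  exists2 g, generator g & ray g = ray p.
Proof.
move=> [Kp p0 ext]; have : hull p by rewrite -nonneg_hull.
move=> [n [c [F [c0 GF pE]]]].
have [i cF] : exists i, c i *: F i != 0.
  apply: contrapT => H; move: p0; rewrite pE big1 ?eqxx // => i _.
  by apply/eqP/negPn/negP => ci; apply: H; exists i.
have [g gg [d /= d0 Fi]] := GF i.
have [] := ext (c i *: F i) (\sum_(j < n | j != i) c j *: F j).
- by rewrite -[_ *: _](big_pred1_eq +%R i (fun j => c j *: F j)); exact: sum_nonneg.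
- exact: sum_nonneg.
- by rewrite pE (bigD1 i).
move=> [e e0 E] _; exists g => //.
have e1 : 0 < e.
  by rewrite lt_neqAle e0 andbT eq_sym; apply: contra cF => /eqP e1; rewrite E e1 scale0r.
rewrite -Fi scalerA in E; have cd : 0 < c i * d.
  rewrite lt_neqAle mulr_ge0 // andbT eq_sym; apply: contra cF => /eqP cd.
  by rewrite -Fi scalerA cd scale0r.
by rewrite -(ray_scale g cd) E ray_scale.
Qed.

End Main.

Theorem theorem2p1 (R : realType) :
  extreme_rays (nonneg_quadratics (@region R)) = [set ray q | q in @generator R]
  /\ nonneg_quadratics (@region R) =
       conic_hull (\bigcup_(q in @generator R) ray q).
Proof.
split; last exact: nonneg_hull.
apply/seteqP; split=> [_ [p /spans_generator[g gg E] <-]|_ [g gg <-]].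
  by exists g.
by exists g => //; exact: generator_spans.
Qed.
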